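(* Let $A$ be a completely contractive Banach algebra and let $X$ be a completely contractive right operator $A$-module via $Q:X\times A\to X$, $(x,a)\mapsto x\cdot a$. The following statements hold. (a) The bilinear map $\mathcal F_Q(A^* )^*\times X^*\to X^*$, $(\mu,x^* )\mapsto\mu\cdot x^*$, where $\langle\mu\cdot x^*,x\rangle=\langle\mu,x^*\cdot x\rangle$, defines a completely contractive left operator $(\mathcal F_Q(A^* )^*,\square)$-module action on $X^*$ such that for each $x^*\in X^*$ the map $\mu\mapsto\mu\cdot x^*:\mathcal F_Q(A^* )^*\to X^*$ is weak$^*$-continuous and $\eta_Q(a)\cdot x^*=a\cdot x^*$ for all $a\in A$. (b) The map $\breve\Gamma_Q:\mathcal F_Q(A^* )^*\to CB(X^* )$, $\breve\Gamma_Q(\mu)(x^* )=\mu\cdot x^*$, is a weak$^*$-continuous completely isometric algebra isomorphism of $(\mathcal F_Q(A^* )^*,\square)$ onto $M_Q$ such that $\breve\Gamma_Q\circ\eta_Q=\Gamma_Q$.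
   Context: A bilinear map $m:X\times Y\to Z$ of operator spaces is completely contractive (c.c.) if $\|[m(x_{ij},y_{kl})]\|_{M_{rs}(Z)}\le\|[x_{ij}]\|_{M_r(X)}\|[y_{kl}]\|_{M_s(Y)}$ for all $r,s$ and all matrices. Operator spaces are complete; $\widehat\otimes$ is the operator space projective tensor product. A c.c. Banach algebra is an associative algebra that is an operator space with c.c. multiplication; c.c. right/left operator $A$-modules are operator spaces with c.c. bilinear module actions. Right action on $A^*$: $\langle\phi\cdot a,b\rangle=\langle\phi,ab\rangle$. Dual left action on $X^*$: $\langle a\cdot x^*,x\rangle=\langle x^*,x\cdot a\rangle$. The operator Fourier space. For $x^*\in X^*$, $x\in X$ define $x^*\cdot x\in A^*$ by $\langle x^*\cdot x,a\rangle=\langle x^*,x\cdot a\rangle$; let $P:X^*\widehat\otimes X\to A^*$ be the complete contraction with $P(x^*\otimes x)=x^*\cdot x$. $\mathcal F_Q(A^* )=P(X^*\widehat\otimes X)$ with the quotient operator space structure of $(X^*\widehat\otimes X)/\ker P$: $\|\phi\|_Q=\inf\{\|\xi\|_\wedge:\xi\in M_n(X^*\widehat\otimes X),\ P_n(\xi)=\phi\}$ for $\phi\in M_n(\mathcal F_Q(A^* ))$. Its operator space dual $\mathcal F_Q(A^* )^*$ is a c.c. Banach algebra under $\langle\mu\,\square\,\nu,\phi\rangle=\langle\mu,\nu\,\square\,\phi\rangle$, where $\nu\,\square\,\phi\in\mathcal F_Q(A^* )$ is given by $\langle\nu\,\square\,\phi,a\rangle=\langle\nu,\phi\cdot a\rangle$;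 and $\eta_Q:A\to\mathcal F_Q(A^* )^*$, $\langle\eta_Q(a),\phi\rangle=\langle\phi,a\rangle$, is a c.c. homomorphism. $CB(X^* )$ has the weak$^*$-topology from the identification $CB(X^* )=(X^*\widehat\otimes X)^*$, $\langle T,x^*\otimes x\rangle=\langle Tx^*,x\rangle$. $\Gamma_Q:A\to CB(X^* )$ is $\Gamma_Q(a)(x^* )=a\cdot x^*$, and $M_Q$ is the weak$^*$-closure of $\Gamma_Q(A)$ in $CB(X^* )$. *)

(* Defs.v *)
From HB Require Import structures.
From mathcomp Require Import all_boot all_order all_algebra.
From mathcomp Require Import complex mxtens.
From mathcomp Require Import mathcomp_extra boolp classical_sets functions reals.
From mathcomp Require Import topology normedtype sequences ring lra.

Set Implicit Arguments.
Unset Strict Implicit.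
Unset Printing Implicit Defensive.

Import Order.TTheory GRing.Theory Num.Theory.
Import numFieldNormedType.Exports.
Import ComplexField.

Local Open Scope classical_set_scope.
Local Open Scope ring_scope.

Notation normc := Normc.normc.

Section OperatorNorm.
Variable R : realType.

Definition l2norm n (v : 'cV[R[i]]_n) : R := Num.sqrt (\sum_i normc (v i 0) ^+ 2).

Definition opnorm m n (a : 'M[R[i]]_(m, n)) : R :=
  sup [set l2norm (a *m v) | v in [set v : 'cV[R[i]]_n | l2norm v <= 1]].

Lemma normc_ge0 (z : R[i]) : 0 <= normc z.
Proof. by case: z => a b; exact: sqrtr_ge0. Qed.

Lemma normc_sum (I : Type) (s : seq I) (F : I -> R[i]) :
  normc (\sum_(i <- s) F i) <= \sum_(i <- s) normc (F i).
Proof.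
elim/big_rec2: _ => [|i y x _ h]; first by rewrite Normc.normc0.
by apply: le_trans (le_normcD _ _) _; rewrite lerD2l.
Qed.

Lemma sum_sqr_ge0 n (f : 'I_n -> R) : 0 <= \sum_i f i ^+ 2.
Proof. by apply: sumr_ge0 => i _; exact: sqr_ge0. Qed.

Lemma cauchy_schwarz n (f g : 'I_n -> R) :
  \sum_i f i * g i <= Num.sqrt (\sum_i f i ^+ 2) * Num.sqrt (\sum_i g i ^+ 2).
Proof.
set A := \sum_i f i ^+ 2; set B := \sum_i g i ^+ 2; set S := \sum_i _.
have A0 : 0 <= A by exact: sum_sqr_ge0.
have B0 : 0 <= B by exact: sum_sqr_ge0.
apply: le_trans (ler_norm S) _; rewrite -sqrtrM // -sqrtr_sqr ler_sqrt; last exact: mulr_ge0.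
have key : 0 <= B * (A * B - S ^+ 2).
  have -> : B * (A * B - S ^+ 2) = \sum_i (B * f i - S * g i) ^+ 2.
    have -> : \sum_i (B * f i - S * g i) ^+ 2 =
      \sum_i (B ^+ 2 * f i ^+ 2 - 2 * B * S * (f i * g i) + S ^+ 2 * g i ^+ 2).
      by apply: eq_bigr => i _; ring.
    by rewrite big_split sumrB -!mulr_sumr /= -/A -/B -/S; ring.
  exact: sum_sqr_ge0.
have [Bz|Bp] := eqVneq B 0.
  have gz i : g i = 0.
    apply/eqP; rewrite -sqrf_eq0; move/eqP: Bz; rewrite psumr_eq0; last by move=> ? _; exact: sqr_ge0.
    by move/allP => /(_ i); rewrite mem_index_enum => /(_ isT).
  have -> : S = 0 by rewrite /S big1 // => i _; rewrite gz mulr0.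
  by rewrite expr0n /= mulr_ge0.
by move: key; rewrite pmulr_rge0 ?subr_ge0 // lt0r Bp.
Qed.

Lemma l2norm_ge0 n (v : 'cV[R[i]]_n) : 0 <= l2norm v.
Proof. exact: sqrtr_ge0. Qed.

Lemma l2norm_sqr n (v : 'cV[R[i]]_n) : l2norm v ^+ 2 = \sum_i normc (v i 0) ^+ 2.
Proof. by rewrite sqr_sqrtr //; exact: sum_sqr_ge0. Qed.

Lemma l2norm_le n (v : 'cV[R[i]]_n) (M : R) : 0 <= M ->
  \sum_i normc (v i 0) ^+ 2 <= M ^+ 2 -> l2norm v <= M.
Proof.
by move=> M0 h; rewrite -(ler_pXn2r (ltn0Sn 1)) ?nnegrE ?l2norm_ge0 // l2norm_sqr.
Qed.

Lemma l2norm0 n : l2norm (0 : 'cV[R[i]]_n) = 0.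
Proof. by rewrite /l2norm big1 ?sqrtr0 // => i _; rewrite mxE Normc.normc0 expr0n. Qed.

Lemma l2normZ n c (v : 'cV[R[i]]_n) : l2norm (c *: v) = normc c * l2norm v.
Proof.
rewrite /l2norm -[X in X * _]ger0_norm ?normc_ge0 // -sqrtr_sqr -sqrtrM ?sqr_ge0 //.
by rewrite mulr_sumr; congr Num.sqrt; apply: eq_bigr => i _; rewrite mxE Normc.normcM exprMn.
Qed.

Lemma l2normD n (v w : 'cV[R[i]]_n) : l2norm (v + w) <= l2norm v + l2norm w.
Proof.
apply: l2norm_le; first by rewrite addr_ge0 ?l2norm_ge0.
rewrite sqrrD !l2norm_sqr.
apply: (@le_trans _ _ (\sum_i (normc (v i 0) + normc (w i 0)) ^+ 2)).
  apply: ler_sum => i _; rewrite mxE ler_pXn2r ?nnegrE ?addr_ge0 ?normc_ge0 //.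
  exact: le_normcD.
have -> : \sum_i (normc (v i 0) + normc (w i 0)) ^+ 2 = \sum_i normc (v i 0) ^+ 2 +
  (\sum_i normc (v i 0) * normc (w i 0)) *+ 2 + \sum_i normc (w i 0) ^+ 2.
  by rewrite -sumrMnl -!big_split /=; apply: eq_bigr => i _; rewrite sqrrD.
rewrite lerD2r lerD2l lerMn2r /=; exact: cauchy_schwarz.
Qed.

Lemma l2norm_entry n (v : 'cV[R[i]]_n) i : normc (v i 0) <= l2norm v.
Proof.
rewrite -(ler_pXn2r (ltn0Sn 1)) ?nnegrE ?l2norm_ge0 ?normc_ge0 // l2norm_sqr.
by rewrite (bigD1 i) //= lerDl; apply: sumr_ge0 => j _; exact: sqr_ge0.
Qed.

Lemma l2norm_eq0 n (v : 'cV[R[i]]_n) : l2norm v = 0 -> v = 0.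
Proof.
move=> v0; apply/matrixP => i j; rewrite (ord1 j) mxE; apply: Normc.eq0_normc.
by apply/eqP; rewrite eq_le normc_ge0 andbT -v0 l2norm_entry.
Qed.

Lemma l2norm_col_mx m n (v : 'cV[R[i]]_m) (w : 'cV[R[i]]_n) :
  l2norm (col_mx v w) ^+ 2 = l2norm v ^+ 2 + l2norm w ^+ 2.
Proof.
rewrite !l2norm_sqr big_split_ord /=.
by congr (_ + _); apply: eq_bigr => i _; rewrite ?col_mxEu ?col_mxEd.
Qed.

Lemma l2norm_sum m (I : Type) (s : seq I) (F : I -> 'cV[R[i]]_m) :
  l2norm (\sum_(i <- s) F i) <= \sum_(i <- s) l2norm (F i).
Proof.
elim/big_rec2: _ => [|i y x _ h]; first by rewrite l2norm0.
by apply: le_trans (l2normD _ _) _; rewrite lerD2l.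
Qed.

Lemma opnorm_has_sup m n (a : 'M[R[i]]_(m, n)) :
  has_sup [set l2norm (a *m v) | v in [set v : 'cV[R[i]]_n | l2norm v <= 1]].
Proof.
split; first by exists (l2norm (a *m 0)); exists 0 => //=; rewrite l2norm0.
exists (\sum_j l2norm (col j a)) => _ [v /= v1 <-].
have -> : a *m v = \sum_j v j 0 *: col j a.
  apply/matrixP => i k; rewrite (ord1 k) summxE mxE.
  by apply: eq_bigr => j _; rewrite !mxE mulrC.
apply: le_trans (l2norm_sum _ _) _; apply: ler_sum => j _; rewrite l2normZ.
rewrite ler_piMl ?l2norm_ge0 //; exact: le_trans (l2norm_entry _ _) v1.
Qed.

Lemma opnorm_ge0 m n (a : 'M[R[i]]_(m, n)) : 0 <= opnorm a.
Proof.
apply: (@le_trans _ _ (l2norm (a *m 0))); first exact: l2norm_ge0.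
apply: sup_upper_bound; first exact: opnorm_has_sup.
by exists 0 => //=; rewrite l2norm0.
Qed.

Lemma l2norm_opnorm m n (a : 'M[R[i]]_(m, n)) v :
  l2norm (a *m v) <= opnorm a * l2norm v.
Proof.
have [v0|vn0] := eqVneq (l2norm v) 0.
  by rewrite v0 mulr0 (l2norm_eq0 v0) mulmx0 l2norm0.
have vp : 0 < l2norm v by rewrite lt0r vn0 l2norm_ge0.
pose c : R[i] := ((l2norm v)^-1)%:C%C.
have nc : normc c = (l2norm v)^-1.
  by rewrite /c /= expr0n addr0 sqrtr_sqr ger0_norm // invr_ge0 ltW.
have : l2norm (a *m (c *: v)) <= opnorm a.
  apply: sup_upper_bound; first exact: opnorm_has_sup.
  by exists (c *: v) => //=; rewrite l2normZ nc mulVf.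
by rewrite -scalemxAr l2normZ nc ler_pdivrMl // mulrC.
Qed.

Lemma opnorm_le m n (a : 'M[R[i]]_(m, n)) (M : R) : 0 <= M ->
  (forall v, l2norm (a *m v) <= M * l2norm v) -> opnorm a <= M.
Proof.
move=> M0 h; apply: ge_sup; first by case: (opnorm_has_sup a).
by move=> _ [v /= v1 <-]; apply: le_trans (h v) _; rewrite ler_piMr.
Qed.

Lemma opnormM m n p (a : 'M[R[i]]_(m, n)) (b : 'M[R[i]]_(n, p)) :
  opnorm (a *m b) <= opnorm a * opnorm b.
Proof.
apply: opnorm_le => [|v]; first by rewrite mulr_ge0 ?opnorm_ge0.
rewrite -mulmxA -mulrA; apply: le_trans (l2norm_opnorm _ _) _.
by rewrite ler_wpM2l ?opnorm_ge0 // l2norm_opnorm.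
Qed.

Lemma opnormD m n (a b : 'M[R[i]]_(m, n)) : opnorm (a + b) <= opnorm a + opnorm b.
Proof.
apply: opnorm_le => [|v]; first by rewrite addr_ge0 ?opnorm_ge0.
rewrite mulmxDl mulrDl; apply: le_trans (l2normD _ _) _.
by rewrite lerD ?l2norm_opnorm.
Qed.

Lemma opnormZ m n c (a : 'M[R[i]]_(m, n)) : opnorm (c *: a) = normc c * opnorm a.
Proof.
have le c' (a' : 'M[R[i]]_(m, n)) : opnorm (c' *: a') <= normc c' * opnorm a'.
  apply: opnorm_le => [|v]; first by rewrite mulr_ge0 ?opnorm_ge0 ?normc_ge0.
  by rewrite -scalemxAl l2normZ -mulrA ler_wpM2l ?normc_ge0 ?l2norm_opnorm.
apply/eqP; rewrite eq_le le /=; have [->|c0] := eqVneq c 0.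
  by rewrite Normc.normc0 mul0r opnorm_ge0.
have nc0 : 0 < normc c.
  by rewrite lt0r normc_ge0 andbT; apply: contra c0 => /eqP/Normc.eq0_normc->.
have := le c^-1 (c *: a); rewrite scalerA mulVf // scale1r Normc.normcV.
by rewrite ler_pdivlMl.
Qed.

Lemma opnorm_eq0 m n (a : 'M[R[i]]_(m, n)) : opnorm a = 0 -> a = 0.
Proof.
move=> a0; apply/matrixP => i j; rewrite mxE.
have : a *m delta_mx j (0 : 'I_1) = 0.
  by apply: l2norm_eq0; apply/eqP; rewrite eq_le l2norm_ge0 andbT -(mul0r (l2norm (delta_mx j (0 : 'I_1)))) -a0 l2norm_opnorm.
by rewrite -colE => /matrixP/(_ i 0); rewrite !mxE.
Qed.

Lemma opnorm_scalar (c : R[i]) : opnorm (c%:M : 'M_1) = normc c.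
Proof.
have h (v : 'cV[R[i]]_1) : l2norm (c%:M *m v) = normc c * l2norm v.
  by rewrite mul_scalar_mx l2normZ.
apply/eqP; rewrite eq_le opnorm_le ?normc_ge0 //=; last by move=> v; rewrite h.
have := l2norm_opnorm (c%:M : 'M[R[i]]_1) (1%:M).
have -> : l2norm (1%:M : 'cV[R[i]]_1) = 1.
  by rewrite /l2norm big_ord1 mxE eqxx Normc.normc1 expr1n sqrtr1.
by rewrite mulr1 mulmx1 -[c%:M]scalemx1 l2normZ /l2norm big_ord1 mxE eqxx Normc.normc1 expr1n sqrtr1 mulr1.
Qed.

Lemma opnorm_block m n (a : 'M[R[i]]_m) (b : 'M[R[i]]_n) :
  opnorm (block_mx a 0 0 b) <= Num.max (opnorm a) (opnorm b).
Proof.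
set M := Num.max _ _.
have aM : opnorm a <= M by rewrite le_max lexx.
have bM : opnorm b <= M by rewrite le_max lexx orbT.
have M0 : 0 <= M by exact: le_trans (opnorm_ge0 a) aM.
apply: opnorm_le => // v; rewrite -(ler_pXn2r (ltn0Sn 1)) ?nnegrE ?mulr_ge0 ?l2norm_ge0 //.
rewrite -[v]vsubmxK mul_block_col !mul0mx addr0 add0r exprMn !l2norm_col_mx mulrDr -!exprMn.
by apply: lerD; rewrite ler_pXn2r ?nnegrE ?mulr_ge0 ?l2norm_ge0 //;
   apply: le_trans (l2norm_opnorm _ _) _; rewrite ler_wpM2r ?l2norm_ge0.
Qed.

Definition selmx m n (s : 'I_m -> 'I_n) : 'M[R[i]]_(m, n) :=
  \matrix_(i, k) (k == s i)%:R.

Lemma opnorm_sel m n (s : 'I_m -> 'I_n) : injective s -> opnorm (selmx s) <= 1.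
Proof.
move=> sI; apply: opnorm_le => // v; rewrite mul1r; apply: l2norm_le; first exact: l2norm_ge0.
rewrite l2norm_sqr.
have -> : \sum_i normc ((selmx s *m v) i 0) ^+ 2 = \sum_i normc (v (s i) 0) ^+ 2.
  apply: eq_bigr => i _; rewrite mxE (bigD1 (s i)) //= mxE eqxx mul1r big1 ?addr0 //.
  by move=> k /negPf ks; rewrite mxE ks mul0r.
rewrite -(big_imset (fun k => normc (v k 0) ^+ 2)) /=; last by move=> i j _ _; exact: sI.
rewrite [leRHS](bigID (mem (s @: 'I_m)%SET)) /= lerDl.
by apply: sumr_ge0 => j _; exact: sqr_ge0.
Qed.

Lemma opnorm_selT m n (s : 'I_m -> 'I_n) : injective s -> opnorm (selmx s)^T <= 1.
Proof.
move=> sI; apply: opnorm_le => // v; rewrite mul1r; apply: l2norm_le; first exact: l2norm_ge0.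
rewrite l2norm_sqr (bigID (mem (s @: 'I_m)%SET)) /=.
rewrite [X in _ + X]big1 ?addr0; last first.
  move=> k /imsetP ks; rewrite mxE big1 ?Normc.normc0 ?expr0n // => i _.
  by rewrite !mxE; case: eqP => [ki|]; rewrite ?mul0r //; case: ks; exists i.
rewrite big_imset /=; last by move=> i j _ _; exact: sI.
apply: ler_sum => i _; rewrite mxE (bigD1 i) //= !mxE eqxx mul1r big1 ?addr0 //.
by move=> k /negPf ki; rewrite !mxE (inj_eq sI) eq_sym ki mul0r.
Qed.

Lemma opnorm_tens1 m n p (a : 'M[R[i]]_(m, n)) :
  opnorm (a *t (1%:M : 'M[R[i]]_p)) <= opnorm a.
Proof.
apply: opnorm_le => [|v]; first exact: opnorm_ge0.
rewrite -(ler_pXn2r (ltn0Sn 1)) ?nnegrE ?mulr_ge0 ?l2norm_ge0 ?opnorm_ge0 //.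
pose w (l : 'I_p) : 'cV[R[i]]_n := \col_k v (mxtens_index (k, l)) 0.
have idx q (F : 'I_(q * p) -> R) :
    \sum_i F i = \sum_l \sum_i F (mxtens_index (i, l)).
  rewrite exchange_big pair_big /=; rewrite (reindex (@mxtens_index q p)) /=.
    by apply: eq_bigr => -[].
  by exists (@mxtens_unindex q p) => ? _; rewrite (mxtens_indexK, mxtens_unindexK).
have idxc q (F : 'I_(q * p) -> R[i]) :
    \sum_i F i = \sum_l \sum_i F (mxtens_index (i, l)).
  rewrite exchange_big pair_big /=; rewrite (reindex (@mxtens_index q p)) /=.
    by apply: eq_bigr => -[].
  by exists (@mxtens_unindex q p) => ? _; rewrite (mxtens_indexK, mxtens_unindexK).
rewrite exprMn !l2norm_sqr !idx mulr_sumr; apply: ler_sum => l _.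
have -> : \sum_i normc (v (mxtens_index (i, l)) 0) ^+ 2 = l2norm (w l) ^+ 2.
  by rewrite l2norm_sqr; apply: eq_bigr => i _; rewrite mxE.
have -> : \sum_i normc (((a *t (1%:M : 'M[R[i]]_p)) *m v) (mxtens_index (i, l)) 0) ^+ 2
    = l2norm (a *m w l) ^+ 2.
  rewrite l2norm_sqr; apply: eq_bigr => i _; congr (normc _ ^+ 2).
  rewrite !mxE idxc (bigD1 l) //= [X in _ + X]big1 ?addr0.
    by apply: eq_bigr => k _; rewrite tensmxE !mxE eqxx mulr1.
  move=> l' /negPf ll'; rewrite big1 // => k _.
  by rewrite tensmxE !mxE eq_sym ll' mulr0 mul0r.
by rewrite -exprMn ler_pXn2r ?nnegrE ?mulr_ge0 ?l2norm_ge0 ?opnorm_ge0 // l2norm_opnorm.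
Qed.

End OperatorNorm.

Section Multiplication.
Variables (R : realType) (V : lmodType R[i]).

(* the product a v b *)
Definition mxact m n (a : 'M[R[i]]_(m, n)) (v : 'M[V]_n) (b : 'M[R[i]]_(n, m)) : 'M[V]_m :=
  \matrix_(i, j) \sum_k \sum_l (a i k * b l j) *: v k l.

Lemma mxactA m n p (a : 'M[R[i]]_(m, n)) (a' : 'M[R[i]]_(n, p)) v b' b :
  mxact a (mxact a' v b') b = mxact (a *m a') v (b' *m b).
Proof.
apply/matrixP => i j; rewrite !mxE.
transitivity (\sum_k \sum_l \sum_k' \sum_l' (a i k * b l j * (a' k k' * b' l' l)) *: v k' l').
  apply: eq_bigr => k _; apply: eq_bigr => l _; rewrite mxE scaler_sumr.
  by apply: eq_bigr => k' _; rewrite scaler_sumr; apply: eq_bigr => l' _; rewrite scalerA.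
transitivity (\sum_k' \sum_l' \sum_k \sum_l (a i k * b l j * (a' k k' * b' l' l)) *: v k' l').
  under eq_bigr do rewrite exchange_big /=.
  rewrite exchange_big /=; apply: eq_bigr => k' _.
  under eq_bigr do rewrite exchange_big /=.
  by rewrite exchange_big.
apply: eq_bigr => k' _; apply: eq_bigr => l' _.
rewrite !mxE mulr_suml scaler_suml; apply: eq_bigr => k _.
rewrite mulr_sumr scaler_suml; apply: eq_bigr => l _.
by congr (_ *: _); ring.
Qed.

Lemma mxactD m n (a : 'M[R[i]]_(m, n)) (v w : 'M[V]_n) b :
  mxact a (v + w) b = mxact a v b + mxact a w b.
Proof.
apply/matrixP => i j; rewrite !mxE -big_split; apply: eq_bigr => k _.
by rewrite -big_split; apply: eq_bigr => l _; rewrite mxE scalerDr.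
Qed.

Lemma mxactZ m n c (a : 'M[R[i]]_(m, n)) (v : 'M[V]_n) b :
  mxact a (map_mx ( *:%R c) v) b = map_mx ( *:%R c) (mxact a v b).
Proof.
apply/matrixP => i j; rewrite !mxE scaler_sumr; apply: eq_bigr => k _.
rewrite scaler_sumr; apply: eq_bigr => l _; rewrite mxE !scalerA; congr (_ *: _); ring.
Qed.

Lemma mxact_scalar m n c (a : 'M[R[i]]_(m, n)) (v : 'M[V]_n) b :
  mxact (c *: a) v b = map_mx ( *:%R c) (mxact a v b).
Proof.
apply/matrixP => i j; rewrite !mxE scaler_sumr; apply: eq_bigr => k _.
by rewrite scaler_sumr; apply: eq_bigr => l _; rewrite mxE scalerA mulrA.
Qed.

Lemma mxact_sel m n (s t : 'I_m -> 'I_n) (v : 'M[V]_n) :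
  mxact (selmx R s) v (selmx R t)^T = mxsub s t v.
Proof.
apply/matrixP => i j; rewrite !mxE (bigD1 (s i)) //= [X in _ + X]big1 ?addr0; last first.
  by move=> k /negPf ks; rewrite big1 // => l _; rewrite !mxE ks mul0r scale0r.
rewrite (bigD1 (t j)) //= [X in _ + X]big1 ?addr0; last first.
  by move=> k /negPf ks; rewrite !mxE ks mulr0 scale0r.
by rewrite !mxE !eqxx mulr1 scale1r.
Qed.

Lemma mxact_block m m' n n' (a : 'M[R[i]]_(m, n)) (a' : 'M[R[i]]_(m', n')) v v' b b' :
  mxact (block_mx a 0 0 a') (block_mx v 0 0 v') (block_mx b 0 0 b') =
  block_mx (mxact a v b) 0 0 (mxact a' v' b').
Proof.
have E := (block_mxEul, block_mxEur, block_mxEdl, block_mxEdr).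
apply/matrixP => i j; rewrite [LHS]mxE.
case: (split_ordP i) => i' ->; case: (split_ordP j) => j' ->; rewrite E mxE.
- rewrite big_split_ord /= [X in _ + X]big1 ?addr0; last first.
    by move=> k _; rewrite big1 // => l _; rewrite E mxE mul0r scale0r.
  apply: eq_bigr => k _; rewrite big_split_ord /= [X in _ + X]big1 ?addr0; last first.
    by move=> l _; rewrite !E !mxE scaler0.
  by apply: eq_bigr => l _; rewrite !E.
- rewrite big1 // => k _; rewrite big1 // => l _.
  case: (split_ordP k) => k' ->; case: (split_ordP l) => l' ->;
    by rewrite !E ?mxE ?(mul0r, mulr0, scale0r, scaler0).
- rewrite big1 // => k _; rewrite big1 // => l _.
  case: (split_ordP k) => k' ->; case: (split_ordP l) => l' ->;
    by rewrite !E ?mxE ?(mul0r, mulr0, scale0r, scaler0).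
- rewrite big_split_ord /= [X in X + _]big1 ?add0r; last first.
    by move=> k _; rewrite big1 // => l _; rewrite E mxE mul0r scale0r.
  apply: eq_bigr => k _; rewrite big_split_ord /= [X in X + _]big1 ?add0r; last first.
    by move=> l _; rewrite !E !mxE scaler0.
  by apply: eq_bigr => l _; rewrite !E.
Qed.

End Multiplication.

(* An abstract operator space: Ruan's axioms (mxnorm_block, mxnorm_act) and
   completeness of the norm of V = M_1(V). *)
HB.mixin Record isOperatorSpace (R : realType) V of GRing.Lmodule R[i] V := {
  mxnorm : forall n, 'M[V]_n -> R;
  mxnorm_eq0 : forall n (v : 'M[V]_n), mxnorm n v = 0 -> v = 0;
  mxnormD : forall n (v w : 'M[V]_n), mxnorm n (v + w) <= mxnorm n v + mxnorm n w;
  mxnormZ : forall n c (v : 'M[V]_n), mxnorm n (map_mx ( *:%R c) v) = normc c * mxnorm n v;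
  mxnorm_block : forall m n (v : 'M[V]_m) (w : 'M[V]_n),
    mxnorm (m + n) (block_mx v 0 0 w) = Num.max (mxnorm m v) (mxnorm n w);
  mxnorm_act : forall m n (a : 'M[R[i]]_(m, n)) (v : 'M[V]_n) (b : 'M[R[i]]_(n, m)),
    mxnorm m (mxact a v b) <= opnorm a * mxnorm n v * opnorm b;
  mxnorm_complete : forall u : nat -> V,
    (forall e : R, 0 < e -> exists N, forall m n, (N <= m)%N -> (N <= n)%N ->
       mxnorm 1 (const_mx (u m - u n)) < e) ->
    exists l, forall e : R, 0 < e -> exists N, forall n, (N <= n)%N ->
       mxnorm 1 (const_mx (u n - l)) < e
}.

#[short(type="opSpaceType")]
HB.structure Definition OperatorSpace (R : realType) :=
  {V of GRing.Lmodule R[i] V & isOperatorSpace R V}.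

Arguments mxnorm {R V n} : rename.
Arguments mxnorm_eq0 {R V n} v : rename.
Arguments mxnormD {R V n} v w : rename.
Arguments mxnormZ {R V n} c v : rename.
Arguments mxnorm_block {R V m n} v w : rename.
Arguments mxnorm_act {R V m n} a v b : rename.

Section OpSpaceTheory.
Variables (R : realType).
Implicit Types V : opSpaceType R.

Lemma block_norm_le (V : lmodType R[i]) (N : forall n, 'M[V]_n -> R) :
  (forall m n (a : 'M[R[i]]_(m, n)) v (b : 'M[R[i]]_(n, m)),
    N m (mxact a v b) <= opnorm a * N n v * opnorm b) ->
  (forall n v, 0 <= N n v) ->
  (forall m n (v : 'M[V]_m) (w : 'M[V]_n),
    N (m + n)%N (block_mx v 0 0 w) <= Num.max (N m v) (N n w)) ->
  forall m n (v : 'M[V]_m) (w : 'M[V]_n),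
    N (m + n)%N (block_mx v 0 0 w) = Num.max (N m v) (N n w).
Proof.
move=> hact h0 hle m n v w; apply/eqP; rewrite eq_le hle /=.
have sub p q (s : 'I_p -> 'I_q) (u : 'M[V]_q) : injective s -> N _ (mxsub s s u) <= N _ u.
  move=> sI; rewrite -mxact_sel; apply: le_trans (hact _ _ _ _ _) _.
  rewrite -[leRHS]mulr1 ler_pM ?mulr_ge0 ?opnorm_ge0 ?opnorm_selT //.
  by rewrite ler_piMl ?h0 ?opnorm_sel.
rewrite ge_max; apply/andP; split.
  have {1}-> : v = mxsub (@lshift m n) (@lshift m n) (block_mx v 0 0 w).
    by apply/matrixP => i j; rewrite mxE block_mxEul.
  exact: (sub _ _ _ _ (@lshift_inj _ _)).
have {1}-> : w = mxsub (@rshift m n) (@rshift m n) (block_mx v 0 0 w).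
  by apply/matrixP => i j; rewrite mxE block_mxEdr.
exact: (sub _ _ _ _ (@rshift_inj _ _)).
Qed.

Definition vnorm V (v : V) : R := mxnorm (const_mx v : 'M[V]_1).

Lemma mxnorm0 V n : mxnorm (0 : 'M[V]_n) = 0.
Proof.
have -> : (0 : 'M[V]_n) = map_mx ( *:%R 0) 0.
  by apply/matrixP => i j; rewrite !mxE scaler0.
by rewrite mxnormZ Normc.normc0 mul0r.
Qed.

Lemma map_mxN1 V n (v : 'M[V]_n) : map_mx ( *:%R (-1)) v = - v.
Proof. by apply/matrixP => i j; rewrite !mxE scaleN1r. Qed.

Lemma mxnormN V n (v : 'M[V]_n) : mxnorm (- v) = mxnorm v.
Proof. by rewrite -map_mxN1 mxnormZ normcN Normc.normc1 mul1r. Qed.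

Lemma mxnorm_ge0 V n (v : 'M[V]_n) : 0 <= mxnorm v.
Proof.
have := mxnormD v (- v); rewrite subrr mxnorm0 mxnormN -mulr2n.
by rewrite pmulrn_lge0.
Qed.

Lemma mxnorm_sub V m n (s : 'I_m -> 'I_n) (v : 'M[V]_n) : injective s ->
  mxnorm (mxsub s s v) <= mxnorm v.
Proof.
move=> sI; rewrite -mxact_sel; apply: le_trans (mxnorm_act _ _ _) _.
rewrite -[leRHS]mulr1 ler_pM ?mulr_ge0 ?opnorm_ge0 ?mxnorm_ge0 ?opnorm_selT //.
by rewrite ler_piMl ?mxnorm_ge0 ?opnorm_sel.
Qed.

Lemma mxnorm_entry V n (v : 'M[V]_n) i j : vnorm (v i j) <= mxnorm v.
Proof.
have -> : vnorm (v i j) = mxnorm (mxact (selmx R (fun _ : 'I_1 => i)) v (selmx R (fun _ => j))^T).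
  by rewrite mxact_sel; congr mxnorm; apply/matrixP => k l; rewrite !mxE.
have I1 (k : 'I_n) : injective (fun _ : 'I_1 => k) by move=> x y _; rewrite !ord1.
apply: le_trans (mxnorm_act _ _ _) _.
rewrite -[leRHS]mulr1 ler_pM ?mulr_ge0 ?opnorm_ge0 ?mxnorm_ge0 ?opnorm_selT //.
by rewrite ler_piMl ?mxnorm_ge0 ?opnorm_sel.
Qed.

Lemma mxnorm_sum V n (I : Type) (s : seq I) (F : I -> 'M[V]_n) :
  mxnorm (\sum_(i <- s) F i) <= \sum_(i <- s) mxnorm (F i).
Proof.
elim/big_rec2: _ => [|i y x _ h]; first by rewrite mxnorm0.
by apply: le_trans (mxnormD _ _) _; rewrite lerD2l.
Qed.

Lemma mxnorm_le_entries V n (v : 'M[V]_n) :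
  mxnorm v <= \sum_i \sum_j vnorm (v i j).
Proof.
pose d (k : 'I_n) : 'M[R[i]]_(n, 1) := (selmx R (fun _ : 'I_1 => k))^T.
have E : v = \sum_i \sum_j mxact (d i) (const_mx (v i j)) (d j)^T.
  apply/matrixP => k l; rewrite summxE (bigD1 k) //= [X in _ + X]big1 ?addr0; last first.
    move=> i /negPf ik; rewrite summxE big1 // => j _.
    by rewrite !mxE !big_ord1 !mxE [k == i]eq_sym ik mul0r scale0r.
  rewrite summxE (bigD1 l) //= [X in _ + X]big1 ?addr0; last first.
    by move=> i /negPf ik; rewrite !mxE !big_ord1 !mxE [l == i]eq_sym ik mulr0 scale0r.
  by rewrite !mxE !big_ord1 !mxE !eqxx mulr1 scale1r.
rewrite {1}E; apply: le_trans (mxnorm_sum _ _) _; apply: ler_sum => i _.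
apply: le_trans (mxnorm_sum _ _) _; apply: ler_sum => j _.
have I1 (k : 'I_n) : injective (fun _ : 'I_1 => k) by move=> x y _; rewrite !ord1.
apply: le_trans (mxnorm_act _ _ _) _; rewrite /d trmxK.
rewrite -[leRHS]mulr1 ler_pM ?mulr_ge0 ?opnorm_ge0 ?mxnorm_ge0 ?opnorm_sel //.
by rewrite ler_piMl ?mxnorm_ge0 ?opnorm_selT.
Qed.

Lemma vnorm0 V : vnorm (0 : V) = 0.
Proof. by rewrite /vnorm; have -> : const_mx (0 : V) = 0 :> 'M_1 by []; rewrite mxnorm0. Qed.

Lemma vnorm_ge0 V (v : V) : 0 <= vnorm v.
Proof. exact: mxnorm_ge0. Qed.

Lemma vnormD V (v w : V) : vnorm (v + w) <= vnorm v + vnorm w.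
Proof. by rewrite /vnorm raddfD mxnormD. Qed.

Lemma vnormN V (v : V) : vnorm (- v) = vnorm v.
Proof. by rewrite /vnorm raddfN mxnormN. Qed.

Lemma vnormB V (v w : V) : vnorm (v - w) = vnorm (w - v).
Proof. by rewrite -vnormN opprB. Qed.

Lemma vnormZ V c (v : V) : vnorm (c *: v) = normc c * vnorm v.
Proof.
rewrite /vnorm -mxnormZ; congr mxnorm; by apply/matrixP => i j; rewrite !mxE.
Qed.

Lemma vnorm_eq0 V (v : V) : vnorm v = 0 -> v = 0.
Proof. by move/mxnorm_eq0/matrixP => /(_ 0 0); rewrite !mxE. Qed.

Lemma vnorm_lim0 V (v : V) : (forall e : R, 0 < e -> vnorm v < e) -> v = 0.
Proof.
move=> h; apply: vnorm_eq0; apply/eqP; rewrite eq_le vnorm_ge0 andbT.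
by apply/ler_addgt0Pl => e e0; rewrite addr0 ltW ?h.
Qed.

Lemma vnorm_sum V (I : Type) (s : seq I) (F : I -> V) :
  vnorm (\sum_(i <- s) F i) <= \sum_(i <- s) vnorm (F i).
Proof.
elim/big_rec2: _ => [|i y x _ h]; first by rewrite vnorm0.
by apply: le_trans (vnormD _ _) _; rewrite lerD2l.
Qed.

Lemma vnorm_telescope V (v w z : V) : vnorm (v - w) <= vnorm (v - z) + vnorm (z - w).
Proof. by apply: le_trans (vnormD _ _); rewrite addrA subrK. Qed.

Lemma mxnorm_lipschitz V n (v w : 'M[V]_n) :
  mxnorm v <= mxnorm w + \sum_i \sum_j vnorm (v i j - w i j).
Proof.
rewrite -[v in leLHS](subrK w) addrC; apply: le_trans (mxnormD _ _) _.
rewrite lerD2l; apply: le_trans (mxnorm_le_entries _) _.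
by apply: ler_sum => i _; apply: ler_sum => j _; rewrite !mxE.
Qed.

End OpSpaceTheory.

Section Scalars.
Variable R : realType.

Lemma real_complete (u : nat -> R) :
  (forall e, 0 < e -> exists N, forall m n, (N <= m)%N -> (N <= n)%N -> `|u m - u n| < e) ->
  exists l, forall e, 0 < e -> exists N, forall n, (N <= n)%N -> `|u n - l| < e.
Proof.
move=> h; have cu : cvg (u @ \oo).
  apply: cauchy_cvg; apply: cauchy_exP => e e0; have [N hN] := h e e0.
  exists (u N); exists N => // n /= Nn; rewrite /ball /=; exact: hN.
exists (lim (u @ \oo)) => e e0.
have /cvgrPdist_lt/(_ e e0)[N _ hN] := cu.
by exists N => n Nn; rewrite distrC; exact: hN.
Qed.

Lemma normc_Re (z : R[i]) : `|complex.Re z| <= normc z.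
Proof.
case: z => a b /=; rewrite -sqrtr_sqr ler_sqrt; last by rewrite addr_ge0 ?sqr_ge0.
by rewrite lerDl sqr_ge0.
Qed.

Lemma normc_Im (z : R[i]) : `|complex.Im z| <= normc z.
Proof.
case: z => a b /=; rewrite -sqrtr_sqr ler_sqrt; last by rewrite addr_ge0 ?sqr_ge0.
by rewrite lerDr sqr_ge0.
Qed.

Lemma normc_ReIm (z : R[i]) : normc z <= `|complex.Re z| + `|complex.Im z|.
Proof.
case: z => a b /=; rewrite -(ler_pXn2r (ltn0Sn 1)) ?nnegrE ?sqrtr_ge0 ?addr_ge0 //.
rewrite sqr_sqrtr ?addr_ge0 ?sqr_ge0 // sqrrD !real_normK ?num_real //.
by rewrite addrAC lerDl mulrn_wge0 ?mulr_ge0.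
Qed.

Lemma complex_complete (u : nat -> R[i]) :
  (forall e : R, 0 < e ->
    exists N, forall m n, (N <= m)%N -> (N <= n)%N -> normc (u m - u n) < e) ->
  exists l, forall e : R, 0 < e -> exists N, forall n, (N <= n)%N -> normc (u n - l) < e.
Proof.
move=> h.
have [a ha] : exists l, forall e : R, 0 < e ->
    exists N, forall n, (N <= n)%N -> `|complex.Re (u n) - l| < e.
  apply: real_complete => e e0; have [N hN] := h e e0; exists N => m n Nm Nn.
  by rewrite -raddfB; apply: le_lt_trans (normc_Re _) _; exact: hN.
have [b hb] : exists l, forall e : R, 0 < e ->
    exists N, forall n, (N <= n)%N -> `|complex.Im (u n) - l| < e.
  apply: real_complete => e e0; have [N hN] := h e e0; exists N => m n Nm Nn.
  by rewrite -raddfB; apply: le_lt_trans (normc_Im _) _; exact: hN.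
exists (a +i* b)%C => e e0.
have [N hN] := ha _ (divr_gt0 e0 (ltr0n _ 2)).
have [M hM] := hb _ (divr_gt0 e0 (ltr0n _ 2)).
exists (maxn N M) => n; rewrite geq_max => /andP[Nn Mn].
apply: le_lt_trans (normc_ReIm _) _; rewrite !raddfB /= (splitr e).
by apply: ltrD; [exact: hN|exact: hM].
Qed.

Let N n (a : 'M[R[i]^o]_n) : R := opnorm (a : 'M[R[i]]_n).

Let mxactE m n (a : 'M[R[i]]_(m, n)) (v : 'M[R[i]^o]_n) (b : 'M[R[i]]_(n, m)) :
  mxact a v b = a *m (v : 'M[R[i]]_n) *m b.
Proof.
apply/matrixP => i j; rewrite !mxE exchange_big; apply: eq_bigr => l _ /=.
rewrite mxE mulr_suml; apply: eq_bigr => k _; rewrite /GRing.scale /=; ring.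
Qed.

Let N_act m n (a : 'M[R[i]]_(m, n)) v (b : 'M[R[i]]_(n, m)) :
  N (mxact a v b) <= opnorm a * N v * opnorm b.
Proof.
rewrite /N mxactE; apply: le_trans (opnormM _ _) _.
by rewrite ler_wpM2r ?opnorm_ge0 // opnormM.
Qed.

Let N_Z n c (v : 'M[R[i]^o]_n) : N (map_mx ( *:%R c) v) = normc c * N v.
Proof. by rewrite /N -opnormZ; congr opnorm; apply/matrixP => i j; rewrite !mxE. Qed.

Let N_complete (u : nat -> R[i]^o) :
  (forall e : R, 0 < e -> exists M, forall m n, (M <= m)%N -> (M <= n)%N ->
    N (const_mx (u m - u n) : 'M_1) < e) ->
  exists l, forall e : R, 0 < e -> exists M, forall n, (M <= n)%N ->
    N (const_mx (u n - l) : 'M_1) < e.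
Proof.
have E (z : R[i]) : N (const_mx z : 'M_1) = normc z.
  rewrite -opnorm_scalar; congr opnorm; apply/matrixP => i j; by rewrite !mxE !ord1.
move=> h; have [l hl] : exists l, forall e : R, 0 < e ->
    exists N, forall n, (N <= n)%N -> normc (u n - l) < e.
  apply: complex_complete => e e0; have [M hM] := h e e0; exists M => m n Mm Mn.
  by rewrite -E; exact: hM.
exists l => e e0; have [M hM] := hl e e0; exists M => n Mn.
by rewrite E; exact: hM.
Qed.

HB.instance Definition _ := @isOperatorSpace.Build R R[i]^o N
  (fun n v => @opnorm_eq0 R n n v) (fun n v w => opnormD v w) N_Z
  (block_norm_le N_act (fun n v => opnorm_ge0 v) (fun m n v w => @opnorm_block R m n v w))
  N_act N_complete.

Lemma vnorm_scalar (z : R[i]^o) : vnorm z = normc z.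
Proof.
by rewrite -opnorm_scalar; congr opnorm; apply/matrixP => i j; rewrite !mxE !ord1.
Qed.

End Scalars.

(* bimx b [x_ij] [y_kl] = [b(x_ij, y_kl)], rows and columns indexed by pairs *)
Definition bimx (X Y Z : Type) (b : X -> Y -> Z) r s (x : 'M[X]_r) (y : 'M[Y]_s) :
    'M[Z]_(r * s) :=
  \matrix_(i, j) b (x (mxtens_unindex i).1 (mxtens_unindex j).1)
                   (y (mxtens_unindex i).2 (mxtens_unindex j).2).

Section Bilinear.
Variable R : realType.

Definition is_bilinear (X Y Z : lmodType R[i]) (b : X -> Y -> Z) : Prop :=
  (forall x, linear (b x)) /\ (forall y, linear (b ^~ y)).

Definition cc_bilinear (X Y Z : opSpaceType R) (b : X -> Y -> Z) : Prop :=
  is_bilinear b /\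
  forall r s (x : 'M[X]_r) (y : 'M[Y]_s), mxnorm (bimx b x y) <= mxnorm x * mxnorm y.

Definition cb_bound (X Y : opSpaceType R) (f : X -> Y) (M : R) : Prop :=
  forall n (x : 'M[X]_n), mxnorm (map_mx f x) <= M * mxnorm x.

End Bilinear.

Section CBMap.
Variables (R : realType) (X Y : opSpaceType R).

Definition cb_pred : {pred X -> Y} :=
  fun f => `[< linear f /\ exists M, cb_bound f M >].

Lemma cb_submod : submod_closed cb_pred.
Proof.
split=> [|c f g /asboolP[fl [M hM]] /asboolP[gl [K hK]]]; apply/asboolP.
  split; first by move=> d x y; change (0 = d *: 0 + 0 :> Y); rewrite scaler0 addr0.
  exists 0 => n x; rewrite mul0r; have -> : map_mx (0 : X -> Y) x = 0; last by rewrite mxnorm0.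
  by apply/matrixP => i j; rewrite !mxE.
split.
  move=> d x y; change (c *: f (d *: x + y) + g (d *: x + y) =
    d *: (c *: f x + g x) + (c *: f y + g y)).
  by rewrite fl gl !scalerDr !scalerA [c * d]mulrC addrACA.
exists (normc c * M + K) => n x.
have -> : map_mx (c *: f + g) x = map_mx ( *:%R c) (map_mx f x) + map_mx g x.
  by apply/matrixP => i j; rewrite !mxE.
rewrite mulrDl; apply: le_trans (mxnormD _ _) _; rewrite lerD //.
by rewrite mxnormZ -mulrA ler_wpM2l ?normc_ge0.
Qed.

HB.instance Definition _ := GRing.isSubmodClosed.Build _ _ cb_pred cb_submod.

Record cbMap := CBMap { cb_fun :> X -> Y; cb_funP : cb_fun \in cb_pred }.

HB.instance Definition _ := [isSub for cb_fun].
HB.instance Definition _ := [Choice of cbMap by <:].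
HB.instance Definition _ := [SubChoice_isSubLmodule of cbMap by <:].

Lemma cb_linear (f : cbMap) : linear f.
Proof. by have /asboolP[] := cb_funP f. Qed.

HB.instance Definition _ (f : cbMap) :=
  GRing.isLinear.Build R[i] X Y _ (cb_fun f) (cb_linear f).

Lemma cb_bounded (f : cbMap) : exists2 M, 0 <= M & cb_bound f M.
Proof.
have /asboolP[_ [M hM]] := cb_funP f; exists (Num.max M 0) => [|n x].
  by rewrite le_max lexx orbT.
by apply: le_trans (hM n x) _; rewrite ler_wpM2r ?mxnorm_ge0 // le_max lexx.
Qed.

Lemma cbMap_eq (f g : cbMap) : f =1 g -> f = g.
Proof. by move=> fg; apply: val_inj; exact: funext. Qed.

Lemma cb0E x : (0 : cbMap) x = 0. Proof. by []. Qed.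
Lemma cbDE (f g : cbMap) x : (f + g) x = f x + g x. Proof. by []. Qed.
Lemma cbNE (f : cbMap) x : (- f) x = - f x. Proof. by []. Qed.
Lemma cbBE (f g : cbMap) x : (f - g) x = f x - g x. Proof. by []. Qed.
Lemma cbZE c (f : cbMap) x : (c *: f) x = c *: f x. Proof. by []. Qed.
Lemma cb_sumE (I : Type) (s : seq I) (P : pred I) (F : I -> cbMap) x :
  (\sum_(i <- s | P i) F i) x = \sum_(i <- s | P i) F i x.
Proof. by elim/big_rec2: _ => // i y g _ <-. Qed.

End CBMap.

Section Convergence.
Variable R : realType.
Implicit Types V W : opSpaceType R.

Definition vcvg V (u : nat -> V) (l : V) : Prop :=
  forall e : R, 0 < e -> exists N, forall n, (N <= n)%N -> vnorm (u n - l) < e.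

Definition vcauchy V (u : nat -> V) : Prop :=
  forall e : R, 0 < e ->
    exists N, forall m n, (N <= m)%N -> (N <= n)%N -> vnorm (u m - u n) < e.

Lemma vcomplete V (u : nat -> V) : vcauchy u -> exists l, vcvg u l.
Proof. exact: mxnorm_complete. Qed.

Lemma vcvg_uniq V (u : nat -> V) l l' : vcvg u l -> vcvg u l' -> l = l'.
Proof.
move=> h h'; apply/eqP; rewrite -subr_eq0; apply/eqP; apply: vnorm_lim0 => e e0.
have [N hN] := h _ (divr_gt0 e0 (ltr0n _ 2)).
have [M hM] := h' _ (divr_gt0 e0 (ltr0n _ 2)).
apply: le_lt_trans (vnorm_telescope _ _ (u (maxn N M))) _; rewrite (splitr e) vnormB.
by apply: ltrD; [apply: hN; exact: leq_maxl|apply: hM; exact: leq_maxr].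
Qed.

Lemma vcvgD V (u v : nat -> V) l m : vcvg u l -> vcvg v m ->
  vcvg (fun n => u n + v n) (l + m).
Proof.
move=> h h' e e0.
have [N hN] := h _ (divr_gt0 e0 (ltr0n _ 2)).
have [M hM] := h' _ (divr_gt0 e0 (ltr0n _ 2)).
exists (maxn N M) => n; rewrite geq_max => /andP[Nn Mn].
rewrite opprD addrACA (splitr e); apply: le_lt_trans (vnormD _ _) _.
by apply: ltrD; [exact: hN|exact: hM].
Qed.

Lemma vcvg_cb V W (f : V -> W) (M : R) (u : nat -> V) l : linear f -> 0 <= M ->
  (forall x, vnorm (f x) <= M * vnorm x) -> vcvg u l -> vcvg (f \o u) (f l).
Proof.
move=> fl M0 hf h e e0; have M1 : 0 < M + 1 by rewrite ltr_wpDl.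
have [N hN] := h _ (divr_gt0 e0 M1); exists N => n Nn /=.
have -> : f (u n) - f l = f (u n - l).
  by have := fl (-1) l (u n); rewrite !scaleN1r [- l + _]addrC [- f l + _]addrC.
apply: le_lt_trans (hf _) _; have := hN n Nn; rewrite ltr_pdivlMr // => h1.
apply: le_lt_trans h1; rewrite mulrC ler_wpM2l ?vnorm_ge0 //; by rewrite lerDl.
Qed.

Lemma vcvgZ V c (u : nat -> V) l : vcvg u l -> vcvg (fun n => c *: u n) (c *: l).
Proof.
apply: (@vcvg_cb _ _ _ (normc c)) => [d x y||x]; rewrite ?normc_ge0 ?vnormZ //.
by rewrite scalerDr !scalerA mulrC.
Qed.

Lemma vcvg_bound V (u : nat -> V) l (M : R) :
  (forall n, vnorm (u n) <= M) -> vcvg u l -> vnorm l <= M.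
Proof.
move=> hu h; apply/ler_addgt0Pl => e e0; have [N hN] := h e e0.
rewrite -[l](subrK (u N)); apply: le_trans (vnormD _ _) _; rewrite lerD //.
by rewrite vnormB ltW // hN.
Qed.

Lemma mx_cvg V n (v : nat -> 'M[V]_n) (l : 'M[V]_n) :
  (forall i j, vcvg (fun k => v k i j) (l i j)) ->
  forall e : R, 0 < e -> exists N, forall k, (N <= k)%N -> mxnorm (v k - l) < e.
Proof.
move=> h e e0; pose d := e / (n * n + 1)%:R.
have d0 : 0 < d by rewrite divr_gt0 // ltr0n addn1.
have /choice[N hN] : forall ij : 'I_n * 'I_n, exists N, forall k, (N <= k)%N ->
    vnorm (v k ij.1 ij.2 - l ij.1 ij.2) < d by move=> ij; exact: h.
exists (\max_ij N ij)%N => k /bigmax_leqP hk.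
apply: le_lt_trans (mxnorm_le_entries _) _.
apply: (@le_lt_trans _ _ (\sum_(i < n) \sum_(j < n) d)).
  apply: ler_sum => i _; apply: ler_sum => j _; rewrite !mxE ltW //.
  exact: (hN (i, j) k (hk (i, j) isT)).
rewrite !sumr_const !card_ord -mulrnA -mulr_natr /d mulrAC ltr_pdivrMr ?ltr0n ?addn1 //.
by rewrite ltr_pM2l // ltr_nat.
Qed.

Lemma mx_cvg_bound V n (v : nat -> 'M[V]_n) (l : 'M[V]_n) (M : R) :
  (forall i j, vcvg (fun k => v k i j) (l i j)) -> (forall k, mxnorm (v k) <= M) ->
  mxnorm l <= M.
Proof.
move=> h hv; apply/ler_addgt0Pl => e e0; have [N hN] := mx_cvg h e0.
rewrite -[l](subrK (v N)); apply: le_trans (mxnormD _ _) _; rewrite lerD //.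
by rewrite -mxnormN opprB ltW // hN.
Qed.

Lemma geo_small (e : R) : 0 < e -> exists N, forall n, (N <= n)%N -> 2^-1 ^+ n < e.
Proof.
move=> e0; have /cvgrPdist_lt/(_ e e0)[N _ hN] : (fun n => (2^-1 : R) ^+ n) @ \oo --> (0 : R).
  by apply: cvg_expr; rewrite ger0_norm ?invr_ge0 ?ler0n // invf_lt1 ?ltr0n // ltr1n.
exists N => n Nn; have := hN n Nn; rewrite sub0r normrN ger0_norm //.
by rewrite exprn_ge0 // invr_ge0 ler0n.
Qed.

Lemma vcauchy_geo V (u : nat -> V) :
  (forall n, vnorm (u n.+1 - u n) <= 2^-1 ^+ n) -> vcauchy u.
Proof.
move=> h.
have bd m k : vnorm (u (m + k)%N - u m) <= 2 * 2^-1 ^+ m.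
  suff : vnorm (u (m + k)%N - u m) <= 2 * 2^-1 ^+ m - 2 * 2^-1 ^+ (m + k).
    by move/le_trans; apply; rewrite gerBl mulr_ge0 // exprn_ge0 // invr_ge0 ler0n.
  elim: k => [|k IH]; first by rewrite addn0 !subrr vnorm0.
  rewrite addnS; apply: le_trans (vnorm_telescope _ _ (u (m + k)%N)) _.
  apply: le_trans (lerD (h _) IH) _; rewrite exprS mulrA divff ?pnatr_eq0 // mul1r.
  set t := 2^-1 ^+ (m + k); rewrite le_eqVlt; apply/orP; left; apply/eqP; ring.
move=> e e0; have [N hN] := geo_small (divr_gt0 e0 (ltr0n _ 4)).
exists N => m n Nm Nn.
have hb k : (N <= k)%N -> vnorm (u k - u N) < e / 2.
  move=> Nk; rewrite -(subnKC Nk); apply: le_lt_trans (bd _ _) _.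
  have := hN N (leqnn N); lra.
apply: le_lt_trans (vnorm_telescope _ _ (u N)) _.
by rewrite (splitr e) ltrD ?hb // vnormB hb.
Qed.

End Convergence.

Section Reindexing.
Variables (R : realType) (Z : opSpaceType R).

Lemma bimx_const1l (X Y : Type) (b : X -> Y -> Z) n (x : X) (y : 'M[Y]_n) :
  mxnorm (bimx b (const_mx x : 'M_1) y) = mxnorm (map_mx (b x) y).
Proof.
pose s (k : 'I_(1 * n)) : 'I_n := (mxtens_unindex k).2.
pose t (k : 'I_n) : 'I_(1 * n) := mxtens_index (ord0, k).
have st : cancel s t by move=> k; rewrite /s /t -[RHS]mxtens_unindexK; congr mxtens_index;
  rewrite [RHS]surjective_pairing; congr pair; rewrite [RHS]ord1.
have ts : cancel t s by move=> k; rewrite /s /t mxtens_indexK.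
apply/eqP; rewrite eq_le; apply/andP; split.
  have -> : bimx b (const_mx x : 'M_1) y = mxsub s s (map_mx (b x) y).
    by apply/matrixP => i j; rewrite !mxE.
  exact/mxnorm_sub/(can_inj st).
have -> : map_mx (b x) y = mxsub t t (bimx b (const_mx x : 'M_1) y).
  by apply/matrixP => i j; rewrite !mxE !mxtens_indexK.
exact/mxnorm_sub/(can_inj ts).
Qed.

Lemma bimx_flip (X Y : Type) (b : X -> Y -> Z) r s (x : 'M[X]_r) (y : 'M[Y]_s) :
  mxnorm (bimx (fun y x => b x y) y x) <= mxnorm (bimx b x y).
Proof.
pose t (k : 'I_(s * r)) : 'I_(r * s) :=
  mxtens_index ((mxtens_unindex k).2, (mxtens_unindex k).1).
have tI : injective t.
  move=> k l /(can_inj (@mxtens_indexK _ _))[h1 h2].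
  by apply: (can_inj (@mxtens_unindexK _ _)); apply: injective_projections; exact: val_inj.
have -> : bimx (fun y x => b x y) y x = mxsub t t (bimx b x y).
  by apply/matrixP => i j; rewrite !mxE /t !mxtens_indexK.
exact: mxnorm_sub.
Qed.

Lemma bimx_decomp (X Y : Type) (b : X -> Y -> Z) r s (x : 'M[X]_r) (y : 'M[Y]_s) :
  mxnorm (bimx b x y) <= \sum_i \sum_j mxnorm (map_mx (b (x i j)) y).
Proof.
pose t (i : 'I_r) (k : 'I_s) : 'I_(r * s) := mxtens_index (i, k).
have tI i : injective (t i) by move=> k l /(can_inj (@mxtens_indexK _ _))[].
have -> : bimx b x y =
    \sum_i \sum_j mxact (selmx R (t i))^T (map_mx (b (x i j)) y) (selmx R (t j)).
  apply/matrixP => k l; case: (mxtens_indexP k) => i p; case: (mxtens_indexP l) => j q.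
  have teq i' p' : (mxtens_index (i, p) == t i' p') = (i == i') && (p == p').
    by rewrite /t (inj_eq (can_inj (@mxtens_indexK _ _))).
  have teq' j' q' : (mxtens_index (j, q) == t j' q') = (j == j') && (q == q').
    by rewrite /t (inj_eq (can_inj (@mxtens_indexK _ _))).
  rewrite !mxE !mxtens_indexK /= summxE (bigD1 i) //= [X in _ = _ + X]big1 ?addr0; last first.
    move=> i' /negPf ii'; rewrite summxE big1 // => j' _; rewrite mxE big1 // => p' _.
    by rewrite big1 // => q' _; rewrite !mxE teq eq_sym ii' mul0r scale0r.
  rewrite summxE (bigD1 j) //= [X in _ = _ + X]big1 ?addr0; last first.
    move=> j' /negPf jj'; rewrite mxE big1 // => p' _.
    by rewrite big1 // => q' _; rewrite !mxE teq' [j == j']eq_sym jj' mulr0 scale0r.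
  rewrite mxE (bigD1 p) //= [X in _ = _ + X]big1 ?addr0; last first.
    move=> p' /negPf pp'; rewrite big1 // => q' _.
    by rewrite !mxE teq [p == p']eq_sym pp' andbF mul0r scale0r.
  rewrite (bigD1 q) //= [X in _ = _ + X]big1 ?addr0; last first.
    by move=> q' /negPf qq'; rewrite !mxE teq' [q == q']eq_sym qq' andbF mulr0 scale0r.
  by rewrite !mxE teq teq' !eqxx mulr1 scale1r.
apply: le_trans (mxnorm_sum _ _) _; apply: ler_sum => i _.
apply: le_trans (mxnorm_sum _ _) _; apply: ler_sum => j _.
apply: le_trans (mxnorm_act _ _ _) _.
rewrite -[leRHS]mulr1 ler_pM ?mulr_ge0 ?opnorm_ge0 ?mxnorm_ge0 ?opnorm_sel //.
by rewrite ler_piMl ?mxnorm_ge0 ?opnorm_selT.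
Qed.

End Reindexing.

Section CBNorm.
Variables (R : realType) (X Y : opSpaceType R).

Definition cb_eval (f : cbMap X Y) (x : X) : Y := f x.

(* M_n(CB(X, Y)) = CB(X, M_n(Y)) *)
Definition cb_norm n (f : 'M[cbMap X Y]_n) : R :=
  sup [set r | exists m (x : 'M[X]_m), mxnorm x <= 1 /\ mxnorm (bimx cb_eval f x) = r].

Lemma cb_norm_has_sup n (f : 'M[cbMap X Y]_n) : has_sup
  [set r | exists m (x : 'M[X]_m), mxnorm x <= 1 /\ mxnorm (bimx cb_eval f x) = r].
Proof.
split; first by exists (mxnorm (bimx cb_eval f (0 : 'M_0))), 0, 0; rewrite mxnorm0.
have /choice[M hM] : forall ij : 'I_n * 'I_n, exists M, 0 <= M /\ cb_bound (f ij.1 ij.2) M.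
  by move=> ij; have [M M0 hM] := cb_bounded (f ij.1 ij.2); exists M.
exists (\sum_i \sum_j M (i, j)) => _ [m [x [x1 <-]]].
apply: le_trans (bimx_decomp _ _ _) _; apply: ler_sum => i _; apply: ler_sum => j _.
have [M0 h] := hM (i, j).
by apply: le_trans (h _ x) _; rewrite ler_piMr.
Qed.

Lemma cb_norm_ge0 n (f : 'M[cbMap X Y]_n) : 0 <= cb_norm f.
Proof.
apply: (@le_trans _ _ (mxnorm (bimx cb_eval f (0 : 'M_0)))); first exact: mxnorm_ge0.
apply: sup_upper_bound; first exact: cb_norm_has_sup.
by exists 0, 0; rewrite mxnorm0.
Qed.

Lemma bimx_cbZ n m (f : 'M[cbMap X Y]_n) c (x : 'M[X]_m) :
  bimx cb_eval f (map_mx ( *:%R c) x) = map_mx ( *:%R c) (bimx cb_eval f x).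
Proof. by apply/matrixP => i j; rewrite !mxE /cb_eval linearZ. Qed.

Lemma cb_norm_ub n m (f : 'M[cbMap X Y]_n) (x : 'M[X]_m) :
  mxnorm (bimx cb_eval f x) <= cb_norm f * mxnorm x.
Proof.
have [x0|xn0] := eqVneq (mxnorm x) 0.
  rewrite x0 mulr0 (mxnorm_eq0 _ x0).
  have -> : bimx cb_eval f (0 : 'M_m) = 0; last by rewrite mxnorm0.
  by apply/matrixP => i j; rewrite !mxE /cb_eval linear0.
have xp : 0 < mxnorm x by rewrite lt0r xn0 mxnorm_ge0.
pose c : R[i] := ((mxnorm x)^-1)%:C%C.
have nc : normc c = (mxnorm x)^-1.
  by rewrite /c /= expr0n addr0 sqrtr_sqr ger0_norm // invr_ge0 ltW.
have : mxnorm (bimx cb_eval f (map_mx ( *:%R c) x)) <= cb_norm f.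
  apply: sup_upper_bound; first exact: cb_norm_has_sup.
  by exists m, (map_mx ( *:%R c) x); rewrite mxnormZ nc mulVf.
by rewrite bimx_cbZ mxnormZ nc ler_pdivrMl // mulrC.
Qed.

Lemma cb_norm_le n (f : 'M[cbMap X Y]_n) (M : R) : 0 <= M ->
  (forall m (x : 'M[X]_m), mxnorm (bimx cb_eval f x) <= M * mxnorm x) -> cb_norm f <= M.
Proof.
move=> M0 h; apply: ge_sup; first by case: (cb_norm_has_sup f).
by move=> _ [m [x [x1 <-]]]; apply: le_trans (h _ x) _; rewrite ler_piMr.
Qed.

Lemma cb_norm_eq0 n (f : 'M[cbMap X Y]_n) : cb_norm f = 0 -> f = 0.
Proof.
move=> f0; apply/matrixP => i j; rewrite mxE; apply: cbMap_eq => x; rewrite cb0E.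
have /mxnorm_eq0/matrixP : mxnorm (bimx cb_eval f (const_mx x : 'M_1)) = 0.
  apply/eqP; rewrite eq_le mxnorm_ge0 andbT; apply: le_trans (cb_norm_ub _ _) _.
  by rewrite f0 mul0r.
by move/(_ (mxtens_index (i, ord0)) (mxtens_index (j, ord0))); rewrite !mxE !mxtens_indexK.
Qed.

Lemma cb_normD n (f g : 'M[cbMap X Y]_n) : cb_norm (f + g) <= cb_norm f + cb_norm g.
Proof.
apply: cb_norm_le => [|m x]; first by rewrite addr_ge0 ?cb_norm_ge0.
have -> : bimx cb_eval (f + g) x = bimx cb_eval f x + bimx cb_eval g x.
  by apply/matrixP => i j; rewrite !mxE.
by rewrite mulrDl; apply: le_trans (mxnormD _ _) _; rewrite lerD ?cb_norm_ub.
Qed.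

Lemma cb_normZ n c (f : 'M[cbMap X Y]_n) :
  cb_norm (map_mx ( *:%R c) f) = normc c * cb_norm f.
Proof.
have le c' (f' : 'M[cbMap X Y]_n) : cb_norm (map_mx ( *:%R c') f') <= normc c' * cb_norm f'.
  apply: cb_norm_le => [|m x]; first by rewrite mulr_ge0 ?cb_norm_ge0 ?normc_ge0.
  have -> : bimx cb_eval (map_mx ( *:%R c') f') x = map_mx ( *:%R c') (bimx cb_eval f' x).
    by apply/matrixP => i j; rewrite !mxE.
  by rewrite mxnormZ -mulrA ler_wpM2l ?normc_ge0 ?cb_norm_ub.
apply/eqP; rewrite eq_le le /=; have [->|c0] := eqVneq c 0.
  by rewrite Normc.normc0 mul0r cb_norm_ge0.
have nc0 : 0 < normc c.
  by rewrite lt0r normc_ge0 andbT; apply: contra c0 => /eqP/Normc.eq0_normc->.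
have := le c^-1 (map_mx ( *:%R c) f).
have -> : map_mx ( *:%R c^-1) (map_mx ( *:%R c) f) = f.
  by apply/matrixP => i j; rewrite !mxE scalerA mulVf // scale1r.
by rewrite Normc.normcV ler_pdivlMl.
Qed.

Lemma cb_norm_block_le m n (f : 'M[cbMap X Y]_m) (g : 'M[cbMap X Y]_n) :
  cb_norm (block_mx f 0 0 g) <= Num.max (cb_norm f) (cb_norm g).
Proof.
set M := Num.max _ _.
have fM : cb_norm f <= M by rewrite le_max lexx.
have gM : cb_norm g <= M by rewrite le_max lexx orbT.
apply: cb_norm_le => [|p x]; first by exact: le_trans (cb_norm_ge0 f) fM.
pose s (k : 'I_((m + n) * p)) : 'I_(m * p + n * p) :=
  match fintype.split (mxtens_unindex k).1 with
  | inl i => lshift _ (mxtens_index (i, (mxtens_unindex k).2))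
  | inr i => rshift _ (mxtens_index (i, (mxtens_unindex k).2))
  end.
have sl i k : s (mxtens_index (lshift n i, k)) = lshift _ (mxtens_index (i, k)).
  by rewrite /s mxtens_indexK /= (unsplitK (inl i)).
have sr i k : s (mxtens_index (rshift m i, k)) = rshift _ (mxtens_index (i, k)).
  by rewrite /s mxtens_indexK /= (unsplitK (inr i)).
have sI : injective s.
  move=> k l; case: (mxtens_indexP k) => i a; case: (mxtens_indexP l) => j b.
  case: (split_ordP i) => i' ->; case: (split_ordP j) => j' ->; rewrite ?sl ?sr.
  - by move/lshift_inj/(can_inj (@mxtens_indexK _ _)) => [-> ->].
  - by move/eqP; rewrite eq_lrshift.
  - by move/eqP; rewrite eq_rlshift.
  - by move/rshift_inj/(can_inj (@mxtens_indexK _ _)) => [-> ->].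
have -> : bimx cb_eval (block_mx f 0 0 g) x =
    mxsub s s (block_mx (bimx cb_eval f x) 0 0 (bimx cb_eval g x)).
  have E := (block_mxEul, block_mxEur, block_mxEdl, block_mxEdr).
  apply/matrixP => k l; case: (mxtens_indexP k) => i a; case: (mxtens_indexP l) => j b.
  rewrite mxE [RHS]mxE !mxtens_indexK /=.
  by case: (split_ordP i) => i' ->; case: (split_ordP j) => j' ->;
     rewrite ?sl ?sr !E ?mxE ?mxtens_indexK.
apply: le_trans (mxnorm_sub _ sI) _; rewrite mxnorm_block ge_max.
by apply/andP; split; apply: le_trans (cb_norm_ub _ _) _; rewrite ler_wpM2r ?mxnorm_ge0.
Qed.

Lemma mxtens_sum (V : zmodType) m n (F : 'I_(m * n) -> V) :
  \sum_k F k = \sum_i \sum_j F (mxtens_index (i, j)).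
Proof.
rewrite pair_big /= (reindex (@mxtens_index m n)) /=; first by apply: eq_bigr => -[].
by exists (@mxtens_unindex m n) => ? _; rewrite (mxtens_indexK, mxtens_unindexK).
Qed.

Lemma cb_norm_act m n (a : 'M[R[i]]_(m, n)) (f : 'M[cbMap X Y]_n) (b : 'M[R[i]]_(n, m)) :
  cb_norm (mxact a f b) <= opnorm a * cb_norm f * opnorm b.
Proof.
apply: cb_norm_le => [|p x]; first by rewrite !mulr_ge0 ?opnorm_ge0 ?cb_norm_ge0.
have -> : bimx cb_eval (mxact a f b) x =
    mxact (a *t (1%:M : 'M_p)) (bimx cb_eval f x) (b *t (1%:M : 'M_p)).
  apply/matrixP => i' j'; case: (mxtens_indexP i') => i q; case: (mxtens_indexP j') => j r.
  rewrite !mxE !mxtens_indexK /= mxtens_sum /cb_eval.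
  rewrite cb_sumE; apply: eq_bigr => k _; rewrite (bigD1 q) //= [X in _ + X]big1 ?addr0; last first.
    move=> q' /negPf qq'; rewrite big1 // => l _.
    by rewrite !mxE !mxtens_indexK /= [q == q']eq_sym qq' mulr0 mul0r scale0r.
  rewrite mxtens_sum cb_sumE; apply: eq_bigr => l _.
  rewrite (bigD1 r) //= [X in _ + X]big1 ?addr0; last first.
    by move=> r' /negPf rr'; rewrite !mxE !mxtens_indexK /= rr' !mulr0 scale0r.
  by rewrite !mxE !mxtens_indexK /= !eqxx !mulr1.
apply: le_trans (mxnorm_act _ _ _) _.
rewrite [leRHS]mulrAC; apply: ler_pM; rewrite ?mulr_ge0 ?opnorm_ge0 ?mxnorm_ge0 //; last exact: opnorm_tens1.
rewrite -mulrA; apply: ler_pM; rewrite ?opnorm_ge0 ?mxnorm_ge0 ?opnorm_tens1 //.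
exact: cb_norm_ub.
Qed.

Lemma cb_norm1_bound (f : cbMap X Y) : cb_bound f (cb_norm (const_mx f : 'M_1)).
Proof. by move=> n x; rewrite -(bimx_const1l cb_eval f x) cb_norm_ub. Qed.

Lemma cb_norm1_le (f : cbMap X Y) (M : R) : 0 <= M -> cb_bound f M ->
  cb_norm (const_mx f : 'M_1) <= M.
Proof. by move=> M0 h; apply: cb_norm_le => // m x; rewrite bimx_const1l. Qed.

Lemma cb_norm_complete (u : nat -> cbMap X Y) :
  (forall e : R, 0 < e -> exists N, forall m n, (N <= m)%N -> (N <= n)%N ->
    cb_norm (const_mx (u m - u n) : 'M_1) < e) ->
  exists l, forall e : R, 0 < e -> exists N, forall n, (N <= n)%N ->
    cb_norm (const_mx (u n - l) : 'M_1) < e.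
Proof.
move=> h.
have bd k l m (x : 'M[X]_m) : mxnorm (map_mx (u k) x - map_mx (u l) x) <=
    cb_norm (const_mx (u k - u l) : 'M_1) * mxnorm x.
  by have := cb_norm1_bound (u k - u l) x; congr (mxnorm _ <= _); apply/matrixP => i j; rewrite !mxE.
have /choice[g hg] : forall x, exists y, vcvg (fun k => u k x) y.
  move=> x; apply: vcomplete => e e0.
  have xp : 0 < vnorm x + 1 by rewrite ltr_wpDl ?vnorm_ge0.
  have [N hN] := h _ (divr_gt0 e0 xp); exists N => k l Nk Nl.
  have -> : vnorm (u k x - u l x) = mxnorm (map_mx (u k) (const_mx x : 'M_1) - map_mx (u l) (const_mx x : 'M_1)).
    by congr mxnorm; apply/matrixP => i j; rewrite !mxE.
  apply: le_lt_trans (bd _ _ _ _) _; have := hN k l Nk Nl; rewrite ltr_pdivlMr //.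
  apply: le_lt_trans; rewrite ler_wpM2l ?cb_norm_ge0 // -/(vnorm x); by rewrite lerDl.
have gl : linear g.
  move=> c x y; apply: (vcvg_uniq (hg _)).
  have -> : (fun k => u k (c *: x + y)) = (fun k => c *: u k x + u k y).
    by apply: funext => k; rewrite linearP.
  by apply: vcvgD; [exact: vcvgZ|].
have hcv n (x : 'M[X]_n) k (M : R) : 0 <= M ->
    (exists N, forall l, (N <= l)%N -> cb_norm (const_mx (u k - u l) : 'M_1) <= M) ->
    mxnorm (map_mx (u k) x - map_mx g x) <= M * mxnorm x.
  move=> M0 [N hN].
  have ent i j : vcvg (fun l => map_mx (u l) x i j) (map_mx g x i j).
    move=> e e0; have [K hK] := hg (x i j) e e0; exists K => l Kl; rewrite !mxE; exact: hK.
  apply/ler_addgt0Pl => e e0; have [K hK] := mx_cvg ent e0.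
  pose l := maxn N K.
  have -> : map_mx (u k) x - map_mx g x =
      (map_mx (u k) x - map_mx (u l) x) + (map_mx (u l) x - map_mx g x).
    by rewrite addrA subrK.
  apply: le_trans (mxnormD _ _) _; rewrite addrC lerD //.
    by rewrite ltW // hK // leq_maxr.
  by apply: le_trans (bd _ _ _ _) _; rewrite ler_wpM2r ?mxnorm_ge0 // hN // leq_maxl.
have gcb : g \in @cb_pred _ X Y.
  apply/asboolP; split=> //; have [N hN] := h 1 ltr01.
  have [M M0 hM] := cb_bounded (u N); exists (1 + M) => n x.
  have -> : map_mx g x = - (map_mx (u N) x - map_mx g x) + map_mx (u N) x.
    by rewrite opprB subrK.
  rewrite mulrDl; apply: le_trans (mxnormD _ _) _; rewrite lerD ?hM // mxnormN.
  apply: hcv => //; exists N => l Nl; exact/ltW/hN.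
exists (CBMap gcb) => e e0; have [N hN] := h _ (divr_gt0 e0 (ltr0n _ 2)); exists N => n Nn.
apply: (@le_lt_trans _ _ (e / 2)); last by rewrite ltr_pdivrMr // ltr_pMr // ltr1n.
apply: cb_norm1_le => [|m x]; first by rewrite ltW // divr_gt0.
have -> : map_mx (u n - CBMap gcb) x = map_mx (u n) x - map_mx g x.
  by apply/matrixP => i j; rewrite !mxE.
apply: hcv; first by rewrite ltW // divr_gt0.
by exists N => l Nl; exact/ltW/hN.
Qed.

HB.instance Definition _ := @isOperatorSpace.Build R (cbMap X Y) cb_norm
  cb_norm_eq0 cb_normD cb_normZ
  (block_norm_le cb_norm_act (fun n f => cb_norm_ge0 f) cb_norm_block_le)
  cb_norm_act cb_norm_complete.

Lemma cb_vnorm_bound (f : cbMap X Y) : cb_bound f (vnorm f).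
Proof. exact: cb_norm1_bound. Qed.

Lemma cb_vnorm_le (f : cbMap X Y) (M : R) : 0 <= M -> cb_bound f M -> vnorm f <= M.
Proof. exact: cb_norm1_le. Qed.

Lemma cb_mxnorm_ub n m (f : 'M[cbMap X Y]_n) (x : 'M[X]_m) :
  mxnorm (bimx cb_eval f x) <= mxnorm f * mxnorm x.
Proof. exact: cb_norm_ub. Qed.

Lemma cb_mxnorm_le n (f : 'M[cbMap X Y]_n) (M : R) : 0 <= M ->
  (forall m (x : 'M[X]_m), mxnorm (bimx cb_eval f x) <= M * mxnorm x) -> mxnorm f <= M.
Proof. exact: cb_norm_le. Qed.

Lemma cb_apply_vnorm (f : cbMap X Y) x : vnorm (f x) <= vnorm f * vnorm x.
Proof.
have := cb_vnorm_bound f (const_mx x : 'M_1); congr (mxnorm _ <= _).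
by apply/matrixP => i j; rewrite !mxE.
Qed.

End CBNorm.

(* every bounded functional is completely bounded, with the same norm *)
Definition odual (R : realType) (X : opSpaceType R) := cbMap X R[i]^o.

Section Image.
Variables (R : realType) (T V : opSpaceType R) (P : cbMap T V).

Definition im_pred : {pred V} := fun v => `[< exists u, P u = v >].

Lemma im_submod : submod_closed im_pred.
Proof.
split=> [|c v w /asboolP[x <-] /asboolP[y <-]]; apply/asboolP.
  by exists 0; rewrite linear0.
by exists (c *: x + y); rewrite linearP.
Qed.

HB.instance Definition _ := GRing.isSubmodClosed.Build _ _ im_pred im_submod.

Record cbImage := CBImage { im_val :> V; im_valP : im_val \in im_pred }.

HB.instance Definition _ := [isSub for im_val].
HB.instance Definition _ := [Choice of cbImage by <:].
HB.instance Definition _ := [SubChoice_isSubLmodule of cbImage by <:].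

(* the quotient matrix norm of T / ker P *)
Definition im_norm n (v : 'M[cbImage]_n) : R :=
  inf [set mxnorm u | u in [set u : 'M[T]_n | map_mx P u = map_mx im_val v]].

Lemma im_lift n (v : 'M[cbImage]_n) : exists u : 'M[T]_n, map_mx P u = map_mx im_val v.
Proof.
have /choice[g hg] : forall w : cbImage, exists u, P u = w by move=> w; have /asboolP := im_valP w.
by exists (map_mx g v); apply/matrixP => i j; rewrite !mxE.
Qed.

Lemma im_has_inf n (v : 'M[cbImage]_n) :
  has_inf [set mxnorm u | u in [set u : 'M[T]_n | map_mx P u = map_mx im_val v]].
Proof.
split; first by have [u hu] := im_lift v; exists (mxnorm u), u.
by exists 0 => _ [u _ <-]; exact: mxnorm_ge0.
Qed.

Lemma im_norm_lb n (v : 'M[cbImage]_n) (u : 'M[T]_n) :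
  map_mx P u = map_mx im_val v -> im_norm v <= mxnorm u.
Proof. by move=> h; apply: inf_lbound; [case: (im_has_inf v)|exists u]. Qed.

Lemma im_norm_ge n (v : 'M[cbImage]_n) (x c : R) : 0 <= c ->
  (forall u : 'M[T]_n, map_mx P u = map_mx im_val v -> x <= c * mxnorm u) ->
  x <= c * im_norm v.
Proof.
rewrite le_eqVlt => /predU1P[<- h|c0 h].
  by have [u hu] := im_lift v; have := h u hu; rewrite !mul0r.
rewrite -ler_pdivrMl //; apply: lb_le_inf; first by case: (im_has_inf v).
by move=> _ [u hu <-]; rewrite ler_pdivrMl // h.
Qed.

Lemma im_norm_near n (v : 'M[cbImage]_n) (e : R) : 0 < e ->
  exists2 u : 'M[T]_n, map_mx P u = map_mx im_val v & mxnorm u < im_norm v + e.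
Proof.
move=> e0; have [_ [u hu <-] h] := inf_adherent e0 (im_has_inf v).
by exists u.
Qed.

Lemma im_norm_ge0 n (v : 'M[cbImage]_n) : 0 <= im_norm v.
Proof.
by rewrite -[im_norm v]mul1r; apply: im_norm_ge => // u _; rewrite mul1r mxnorm_ge0.
Qed.

Lemma im_norm_eq0 n (v : 'M[cbImage]_n) : im_norm v = 0 -> v = 0.
Proof.
move=> v0; have [M M0 hM] := cb_bounded P.
have /mxnorm_eq0/matrixP h : mxnorm (map_mx im_val v) = 0.
  apply/eqP; rewrite eq_le mxnorm_ge0 andbT -(mulr0 M) -v0.
  by apply: im_norm_ge => // u <-; exact: hM.
by apply/matrixP => i j; apply: val_inj; have := h i j; rewrite !mxE.
Qed.

Lemma im_normD n (v w : 'M[cbImage]_n) : im_norm (v + w) <= im_norm v + im_norm w.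
Proof.
apply/ler_addgt0Pl => e e0; have e2 := divr_gt0 e0 (ltr0n R 2).
have [x hx xv] := im_norm_near v e2; have [y hy yw] := im_norm_near w e2.
have h : map_mx P (x + y) = map_mx im_val (v + w).
  apply/matrixP => i j; move/matrixP/(_ i j): hx; move/matrixP/(_ i j): hy.
  by rewrite !mxE => hyij hxij; rewrite (linearD P) /= hxij hyij.
apply: le_trans (im_norm_lb h) _; apply: le_trans (mxnormD _ _) _; lra.
Qed.

Lemma im_normZ n c (v : 'M[cbImage]_n) : im_norm (map_mx ( *:%R c) v) = normc c * im_norm v.
Proof.
have le c' (v' : 'M[cbImage]_n) : im_norm (map_mx ( *:%R c') v') <= normc c' * im_norm v'.
  apply: im_norm_ge => [|u hu]; first exact: normc_ge0.
  rewrite -mxnormZ; apply: im_norm_lb; apply/matrixP => i j.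
  by move/matrixP/(_ i j): hu; rewrite !mxE linearZ /= => ->.
apply/eqP; rewrite eq_le le /=; have [->|c0] := eqVneq c 0.
  by rewrite Normc.normc0 mul0r im_norm_ge0.
have nc0 : 0 < normc c.
  by rewrite lt0r normc_ge0 andbT; apply: contra c0 => /eqP/Normc.eq0_normc->.
have := le c^-1 (map_mx ( *:%R c) v).
have -> : map_mx ( *:%R c^-1) (map_mx ( *:%R c) v) = v.
  by apply/matrixP => i j; rewrite !mxE scalerA mulVf // scale1r.
by rewrite Normc.normcV ler_pdivlMl.
Qed.

Lemma im_norm_block_le m n (v : 'M[cbImage]_m) (w : 'M[cbImage]_n) :
  im_norm (block_mx v 0 0 w) <= Num.max (im_norm v) (im_norm w).
Proof.
apply/ler_addgt0Pl => e e0.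
have [x hx xv] := im_norm_near v e0; have [y hy yw] := im_norm_near w e0.
have h : map_mx P (block_mx x 0 0 y) = map_mx im_val (block_mx v 0 0 w).
  by rewrite !map_block_mx hx hy; congr block_mx; apply/matrixP => i j; rewrite !mxE linear0.
apply: le_trans (im_norm_lb h) _; rewrite mxnorm_block ge_max.
apply/andP; split; [apply: le_trans (ltW xv) _|apply: le_trans (ltW yw) _];
  by rewrite addrC lerD2l le_max lexx ?orbT.
Qed.

Lemma linear_mxact (W W' : lmodType R[i]) (f : {linear W -> W'}) m n
    (a : 'M[R[i]]_(m, n)) (v : 'M[W]_n) (b : 'M[R[i]]_(n, m)) :
  map_mx f (mxact a v b) = mxact a (map_mx f v) b.
Proof.
apply/matrixP => i j; rewrite !mxE linear_sum; apply: eq_bigr => k _.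
by rewrite linear_sum; apply: eq_bigr => l _; rewrite linearZ mxE.
Qed.

Lemma im_norm_act m n (a : 'M[R[i]]_(m, n)) (v : 'M[cbImage]_n) (b : 'M[R[i]]_(n, m)) :
  im_norm (mxact a v b) <= opnorm a * im_norm v * opnorm b.
Proof.
rewrite mulrAC; apply: im_norm_ge => [|u hu]; first by rewrite mulr_ge0 ?opnorm_ge0.
have h : map_mx P (mxact a u b) = map_mx im_val (mxact a v b).
  rewrite linear_mxact /= hu; exact/esym/(linear_mxact (val : {linear cbImage -> V})).
by apply: le_trans (im_norm_lb h) _; rewrite mulrAC mxnorm_act.
Qed.

Lemma im_norm1_near (v : cbImage) (e : R) : im_norm (const_mx v : 'M_1) < e ->
  exists2 u, P u = v & vnorm u < e.
Proof.
move=> h; have e0 : 0 < e - im_norm (const_mx v : 'M_1) by rewrite subr_gt0.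
have [u hu] := im_norm_near (const_mx v : 'M_1) e0; rewrite addrC subrK => ue.
exists (u 0 0); first by move/matrixP/(_ 0 0): hu; rewrite !mxE.
by apply: le_lt_trans ue; exact: mxnorm_entry.
Qed.

Lemma im_norm1_lb (v : cbImage) u : P u = v -> im_norm (const_mx v : 'M_1) <= vnorm u.
Proof. by move=> h; apply: im_norm_lb; apply/matrixP => i j; rewrite !mxE. Qed.

Lemma im_norm_complete (u : nat -> cbImage) :
  (forall e : R, 0 < e -> exists N, forall m n, (N <= m)%N -> (N <= n)%N ->
    im_norm (const_mx (u m - u n) : 'M_1) < e) ->
  exists l, forall e : R, 0 < e -> exists N, forall n, (N <= n)%N ->
    im_norm (const_mx (u n - l) : 'M_1) < e.
Proof.
move=> h; pose q : R := 2^-1.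
have q0 k : 0 < q ^+ k by rewrite exprn_gt0 // invr_gt0 ltr0n.
have /choice[N hN] : forall k, exists N, forall m n, (N <= m)%N -> (N <= n)%N ->
  im_norm (const_mx (u m - u n) : 'M_1) < q ^+ k by move=> k; exact: h.
pose N' k := (\max_(i < k.+1) N i)%N.
have NN k : (N k <= N' k)%N.
  by apply: (leq_bigmax (F := fun i : 'I_k.+1 => N i) ord_max).
have Nmono k : (N' k <= N' k.+1)%N.
  apply/bigmax_leqP => i _.
  exact: (leq_bigmax (F := fun i : 'I_k.+2 => N i) (widen_ord (leqnSn k.+1) i)).
have /choice[d hd] : forall k, exists x, P x = val (u (N' k.+1) - u (N' k)) /\ vnorm x <= q ^+ k.
  move=> k; have [x Px xq] : exists2 x, P x = (u (N' k.+1) - u (N' k)) & vnorm x < q ^+ k.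
    apply: im_norm1_near; apply: hN; last exact: NN.
    exact: leq_trans (NN k) (Nmono k).
  by exists x; split=> //; exact: ltW.
have [x0 Px0] : exists x, P x = val (u (N' 0%N)) by have /asboolP := im_valP (u (N' 0%N)).
pose s k := x0 + \sum_(i < k) d i.
have Ps k : P (s k) = val (u (N' k)).
  elim: k => [|k IH]; first by rewrite /s big_ord0 addr0.
  by rewrite /s big_ord_recr addrA linearD /= -/(s k) IH (hd k).1 raddfB /= addrC subrK.
have [y hy] : exists y, vcvg s y.
  apply/vcomplete/vcauchy_geo => k.
  by rewrite /s big_ord_recr addrA [X in vnorm X]addrC addKr; exact: (hd k).2.
have yP : P y \in im_pred by apply/asboolP; exists y.
exists (CBImage yP) => e e0; have e2 := divr_gt0 e0 (ltr0n R 2).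
have [K hK] := hy _ e2; have [M hM] := h _ e2; have [L hL] := geo_small e2.
pose k := maxn K L.
exists (maxn M (N k)) => n; rewrite geq_max => /andP[Mn kn].
have -> : u n - CBImage yP = (u n - u (N' k)) + (u (N' k) - CBImage yP).
  by rewrite addrA subrK.
rewrite raddfD; apply: le_lt_trans (im_normD _ _) _; rewrite (splitr e); apply: ltrD.
  apply: lt_le_trans (hN k _ _ kn (NN k)) _; exact/ltW/hL/leq_maxr.
apply: le_lt_trans (hK k (leq_maxl _ _)); apply: im_norm1_lb.
by rewrite linearB /= Ps.
Qed.

HB.instance Definition _ := @isOperatorSpace.Build R cbImage im_norm
  im_norm_eq0 im_normD im_normZ
  (block_norm_le im_norm_act (fun n v => im_norm_ge0 v) im_norm_block_le)
  im_norm_act im_norm_complete.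

Lemma im_mxnorm_ge n (v : 'M[cbImage]_n) (x c : R) : 0 <= c ->
  (forall u : 'M[T]_n, map_mx P u = map_mx im_val v -> x <= c * mxnorm u) ->
  x <= c * mxnorm v.
Proof. exact: im_norm_ge. Qed.

Lemma im_mxnorm_lb n (v : 'M[cbImage]_n) (u : 'M[T]_n) :
  map_mx P u = map_mx im_val v -> mxnorm v <= mxnorm u.
Proof. exact: im_norm_lb. Qed.

Lemma im_proj_proof u : P u \in im_pred.
Proof. by apply/asboolP; exists u. Qed.

Definition im_proj (u : T) : cbImage := CBImage (im_proj_proof u).

Lemma im_projP (v : cbImage) : exists u, v = im_proj u.
Proof. by have /asboolP[u hu] := im_valP v; exists u; apply: val_inj. Qed.

End Image.

Section CBMaps.
Variable R : realType.
Implicit Types X Y Z W : opSpaceType R.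

Lemma cb_mkP X Y (f : X -> Y) (M : R) : linear f -> cb_bound f M -> f \in @cb_pred _ X Y.
Proof. by move=> fl fM; apply/asboolP; split=> //; exists M. Qed.

Lemma cb_comp_proof X Y Z (g : cbMap Y Z) (f : cbMap X Y) : g \o f \in @cb_pred _ X Z.
Proof.
have [M M0 hM] := cb_bounded g; have [K K0 hK] := cb_bounded f.
apply: (@cb_mkP _ _ _ (M * K)) => [c x y|n x] /=; first by rewrite !linearP.
rewrite map_mx_comp; apply: le_trans (hM _ _) _.
by rewrite -mulrA ler_wpM2l.
Qed.

Definition cb_comp X Y Z (g : cbMap Y Z) (f : cbMap X Y) : cbMap X Z :=
  CBMap (cb_comp_proof g f).

Lemma cc_flip X Y Z (b : X -> Y -> Z) : cc_bilinear b -> cc_bilinear (fun y x => b x y).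
Proof.
move=> [[bl br] hb]; split; first by split.
move=> r s y x; apply: le_trans (bimx_flip _ _ _) _; rewrite mulrC; exact: hb.
Qed.

Section Cc.
Variables (X Y Z : opSpaceType R) (b : X -> Y -> Z) (hb : cc_bilinear b).

Lemma cc_left_bound x : cb_bound (b x) (vnorm x).
Proof. by move=> n y; rewrite -(bimx_const1l b x y); exact: hb.2. Qed.

Lemma cc_left_proof x : b x \in @cb_pred _ Y Z.
Proof. exact: cb_mkP (hb.1.1 x) (cc_left_bound x). Qed.

Definition cc_left (x : X) : cbMap Y Z := CBMap (cc_left_proof x).

End Cc.

Section Adjoint.
Variables (X Y Z W : opSpaceType R) (b : X -> Y -> Z) (hb : cc_bilinear b).

Definition adjoint (f : cbMap Z W) (x : X) : cbMap Y W := cb_comp f (cc_left hb x).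

Lemma adjointE f x y : adjoint f x y = f (b x y).
Proof. by []. Qed.

Lemma adjoint_cc : cc_bilinear adjoint.
Proof.
split.
  split=> [f c x x'|x c f f']; apply: cbMap_eq => y.
    by rewrite cbDE cbZE !adjointE (hb.1.2 y c x x') linearP.
  by rewrite cbDE cbZE !adjointE cbDE cbZE.
move=> r s f x; apply: cb_mxnorm_le => [|t y]; first by rewrite mulr_ge0 ?mxnorm_ge0.
pose p (k : 'I_(r * s * t)) : 'I_(r * (s * t)) :=
  mxtens_index ((mxtens_unindex (mxtens_unindex k).1).1,
    mxtens_index ((mxtens_unindex (mxtens_unindex k).1).2, (mxtens_unindex k).2)).
have pE i j k : p (mxtens_index (mxtens_index (i, j), k)) = mxtens_index (i, mxtens_index (j, k)).
  by rewrite /p !mxtens_indexK.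
have pI : injective p.
  move=> k l; case: (mxtens_indexP k) => k' c; case: (mxtens_indexP k') => i j.
  case: (mxtens_indexP l) => l' c'; case: (mxtens_indexP l') => i' j'.
  rewrite !pE => /(can_inj (@mxtens_indexK _ _))/pair_equal_spec[->].
  by move/(can_inj (@mxtens_indexK _ _))/pair_equal_spec => [-> ->].
have -> : bimx (@cb_eval _ Y W) (bimx adjoint f x) y =
    mxsub p p (bimx (@cb_eval _ Z W) f (bimx b x y)).
  by apply/matrixP => k l; rewrite !mxE /p !mxtens_indexK.
apply: le_trans (mxnorm_sub _ pI) _; apply: le_trans (cb_mxnorm_ub _ _) _.
by rewrite -mulrA ler_wpM2l ?mxnorm_ge0 //; exact: hb.2.
Qed.

End Adjoint.

Lemma cb_eval_cc X Y : cc_bilinear (@cb_eval _ X Y).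
Proof.
split; last by move=> r s f x; exact: cb_mxnorm_ub.
by split=> [f c x y|x c f g]; rewrite /cb_eval ?linearP ?cbDE ?cbZE.
Qed.

End CBMaps.
Arguments adjoint_cc {R X Y Z W b} hb.

Section ProjectiveTensor.
Variable R : realType.

Definition tens_sum (X Y : Type) (V : zmodType) (b : X -> Y -> V) (s : seq (X * Y)) : V :=
  \sum_(p <- s) b p.1 p.2.

(* The operator space projective tensor product of X and Y, up to completely
   isometric isomorphism: a completion of the algebraic tensor product (pt_alg)
   for the norms inf {|a| |x| |y| |c| : u = a (x (x) y) c} on matrices. *)
Record projTensor (X Y : opSpaceType R) := ProjTensor {
  pt_space :> opSpaceType R;
  pt_tens : X -> Y -> pt_space;
  pt_bilinear : is_bilinear pt_tens;
  pt_alg : forall (W : lmodType R[i]) (b : X -> Y -> W), is_bilinear b ->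
    forall s : seq (X * Y), tens_sum pt_tens s = 0 -> tens_sum b s = 0;
  pt_norm : forall n (s : 'M[seq (X * Y)]_n),
    mxnorm (map_mx (tens_sum pt_tens) s) =
    inf [set r | exists p q (a : 'M[R[i]]_(n, p * q)) (x : 'M[X]_p) (y : 'M[Y]_q)
                   (c : 'M[R[i]]_(p * q, n)),
      map_mx (tens_sum pt_tens) s = mxact a (bimx pt_tens x y) c /\
      r = opnorm a * mxnorm x * mxnorm y * opnorm c];
  pt_dense : forall (u : pt_space) (e : R), 0 < e ->
    exists s : seq (X * Y), vnorm (u - tens_sum pt_tens s) < e
}.

End ProjectiveTensor.

Section TensorExtension.
Variables (R : realType) (X Y : opSpaceType R).

Definition lscale (c : R[i]) (s : seq (X * Y)) : seq (X * Y) :=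
  [seq (c *: p.1, p.2) | p <- s].

Lemma tens_sum_cat (V : zmodType) (b : X -> Y -> V) s s' :
  tens_sum b (s ++ s') = tens_sum b s + tens_sum b s'.
Proof. exact: big_cat. Qed.

Lemma bilinear0l (V : lmodType R[i]) (b : X -> Y -> V) y : is_bilinear b -> b 0 y = 0.
Proof.
move=> [_ br]; have := br y 1 0 0; rewrite /= !scaler0 !addr0 scale1r.
by move=> b0; apply: (@addrI _ (b 0 y)); rewrite -b0 addr0.
Qed.

Lemma tens_sum_scale (V : lmodType R[i]) (b : X -> Y -> V) c s : is_bilinear b ->
  tens_sum b (lscale c s) = c *: tens_sum b s.
Proof.
move=> hb; rewrite /tens_sum big_map scaler_sumr; apply: eq_bigr => p _ /=.
by have := hb.2 p.2 c p.1 0; rewrite /= (bilinear0l _ hb) !addr0.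
Qed.

(* u = a (x (x) y) c *)
Definition tens_rep (V : lmodType R[i]) (t : X -> Y -> V) n (u : 'M[V]_n) : Prop :=
  exists p q (a : 'M[R[i]]_(n, p * q)) (x : 'M[X]_p) (y : 'M[Y]_q)
    (c : 'M[R[i]]_(p * q, n)), u = mxact a (bimx t x y) c.

Lemma tens_rep0 (V : lmodType R[i]) (t : X -> Y -> V) n : tens_rep t (0 : 'M_n).
Proof.
exists 0%N, 0%N, 0, 0, 0, 0; apply/matrixP => i j; rewrite !mxE big1 // => k _.
by rewrite big1 // => l _; rewrite !mxE mul0r scale0r.
Qed.

Lemma tens_repD (V : lmodType R[i]) (t : X -> Y -> V) n (u v : 'M_n) : is_bilinear t ->
  tens_rep t u -> tens_rep t v -> tens_rep t (u + v).
Proof.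
move=> ht [p [q [a [x [y [c ->]]]]]] [p' [q' [a' [x' [y' [c' ->]]]]]].
pose g (f : 'I_p -> 'I_q -> R[i]) (f' : 'I_p' -> 'I_q' -> R[i]) (k : 'I_((p + p') * (q + q'))) :=
  match fintype.split (mxtens_unindex k).1, fintype.split (mxtens_unindex k).2 with
  | inl i, inl j => f i j
  | inr i, inr j => f' i j
  | _, _ => 0
  end.
have gll f f' i j : g f f' (mxtens_index (lshift _ i, lshift _ j)) = f i j.
  by rewrite /g mxtens_indexK /= (unsplitK (inl i)) (unsplitK (inl j)).
have glr f f' i j : g f f' (mxtens_index (lshift _ i, rshift _ j)) = 0.
  by rewrite /g mxtens_indexK /= (unsplitK (inl i)) (unsplitK (inr j)).
have grl f f' i j : g f f' (mxtens_index (rshift _ i, lshift _ j)) = 0.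
  by rewrite /g mxtens_indexK /= (unsplitK (inr i)) (unsplitK (inl j)).
have grr f f' i j : g f f' (mxtens_index (rshift _ i, rshift _ j)) = f' i j.
  by rewrite /g mxtens_indexK /= (unsplitK (inr i)) (unsplitK (inr j)).
have gs (W : zmodType) (F : 'I_((p + p') * (q + q')) -> W) :
    (forall i j, F (mxtens_index (lshift _ i, rshift _ j)) = 0) ->
    (forall i j, F (mxtens_index (rshift _ i, lshift _ j)) = 0) ->
    \sum_k F k = \sum_i \sum_j F (mxtens_index (lshift _ i, lshift _ j)) +
                 \sum_i \sum_j F (mxtens_index (rshift _ i, rshift _ j)).
  move=> F1 F2; rewrite mxtens_sum big_split_ord /=; congr (_ + _); apply: eq_bigr => i _;
    rewrite big_split_ord /=.
    by rewrite [X in _ + X]big1 ?addr0.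
  by rewrite [X in X + _]big1 ?add0r.
pose A : 'M[R[i]]_(n, _) := \matrix_(i, k)
  g (fun k l => a i (mxtens_index (k, l))) (fun k l => a' i (mxtens_index (k, l))) k.
pose C : 'M[R[i]]_(_, n) := \matrix_(k, j)
  g (fun k l => c (mxtens_index (k, l)) j) (fun k l => c' (mxtens_index (k, l)) j) k.
have AE i k : A i k =
    g (fun k l => a i (mxtens_index (k, l))) (fun k l => a' i (mxtens_index (k, l))) k.
  by rewrite mxE.
have CE k j : C k j =
    g (fun k l => c (mxtens_index (k, l)) j) (fun k l => c' (mxtens_index (k, l)) j) k.
  by rewrite mxE.
have bE p1 q1 (x1 : 'M[X]_p1) (y1 : 'M[Y]_q1) i k j l :
    bimx t x1 y1 (mxtens_index (i, k)) (mxtens_index (j, l)) = t (x1 i j) (y1 k l).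
  by rewrite mxE !mxtens_indexK.
exists (p + p')%N, (q + q')%N, A, (block_mx x 0 0 x'), (block_mx y 0 0 y'), C.
apply/matrixP => i j; rewrite mxE [in LHS]mxE [RHS]mxE [X in _ + X = _]mxE gs; first last.
- by move=> k l; rewrite big1 // => m _; rewrite AE grl mul0r scale0r.
- by move=> k l; rewrite big1 // => m _; rewrite AE glr mul0r scale0r.
have E := (block_mxEul, block_mxEur, block_mxEdl, block_mxEdr).
congr (_ + _).
  rewrite mxtens_sum; apply: eq_bigr => k _; apply: eq_bigr => l _.
  rewrite [RHS]gs; first last.
  - by move=> k' l'; rewrite CE grl mulr0 scale0r.
  - by move=> k' l'; rewrite CE glr mulr0 scale0r.
  rewrite [X in _ = _ + X]big1 ?addr0; last first.
    move=> k' _; rewrite big1 // => l' _; rewrite bE !E [X in t X _]mxE.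
    by rewrite (bilinear0l _ ht) scaler0.
  rewrite mxtens_sum; apply: eq_bigr => k' _; apply: eq_bigr => l' _.
  by rewrite AE CE !gll !bE !E.
rewrite mxtens_sum; apply: eq_bigr => k _; apply: eq_bigr => l _.
rewrite [RHS]gs; first last.
- by move=> k' l'; rewrite CE grl mulr0 scale0r.
- by move=> k' l'; rewrite CE glr mulr0 scale0r.
rewrite [X in _ = X + _]big1 ?add0r; last first.
  move=> k' _; rewrite big1 // => l' _; rewrite bE !E [X in t X _]mxE.
  by rewrite (bilinear0l _ ht) scaler0.
rewrite mxtens_sum; apply: eq_bigr => k' _; apply: eq_bigr => l' _.
by rewrite AE CE !grr !bE !E.
Qed.

Lemma tens_rep_sum (V : lmodType R[i]) (t : X -> Y -> V) n (s : 'M[seq (X * Y)]_n) :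
  is_bilinear t -> tens_rep t (map_mx (tens_sum t) s).
Proof.
move=> ht; have -> : map_mx (tens_sum t) s =
    \sum_i \sum_j \sum_(p <- s i j)
      (\matrix_(k, l) if (k == i) && (l == j) then t p.1 p.2 else 0).
  apply/matrixP => i j; rewrite mxE summxE (bigD1 i) //= [X in _ + X]big1 ?addr0; last first.
    move=> i' /negPf ii'; rewrite summxE big1 // => j' _; rewrite summxE big1 // => p _.
    by rewrite mxE eq_sym ii'.
  rewrite summxE (bigD1 j) //= [X in _ + X]big1 ?addr0; last first.
    move=> j' /negPf jj'; rewrite summxE big1 // => p _.
    by rewrite mxE [j == j']eq_sym jj' andbF.
  by rewrite summxE; apply: eq_bigr => p _; rewrite mxE !eqxx.
have sum (I : Type) (r : seq I) (F : I -> 'M[V]_n) :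
    (forall i, tens_rep t (F i)) -> tens_rep t (\sum_(i <- r) F i).
  move=> hF; elim/big_rec: _ => [|i u _ hu]; first exact: tens_rep0.
  exact: tens_repD.
apply: (sum) => i; apply: (sum) => j; apply: (sum) => p.
exists 1%N, 1%N, (\matrix_(k, _) (k == i)%:R), (const_mx p.1), (const_mx p.2),
  (\matrix_(_, l) (l == j)%:R).
apply/matrixP => k l; rewrite !mxE !big_ord1 !mxE.
by case: (k == i); case: (l == j); rewrite ?(mul1r, mul0r) ?(scale1r, scale0r).
Qed.

Lemma mxact1 (V : lmodType R[i]) n (v : 'M[V]_n) : mxact 1%:M v 1%:M = v.
Proof.
have E : 1%:M = selmx R (@id 'I_n) by apply/matrixP => i j; rewrite !mxE eq_sym.
rewrite -[X in mxact _ _ X]trmx1 E mxact_sel; by apply/matrixP => i j; rewrite !mxE.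
Qed.

Variable T : projTensor X Y.
Notation tens := (@pt_tens R X Y T).
Notation S := (tens_sum tens).

Lemma tens_bimx_cc : cc_bilinear tens.
Proof.
split; first exact: pt_bilinear.
move=> r q x y; pose s : 'M[seq (X * Y)]_(r * q) := bimx (fun a b => [:: (a, b)]) x y.
have sE : map_mx S s = bimx tens x y.
  by apply/matrixP => i j; rewrite !mxE /tens_sum big_seq1.
rewrite -sE pt_norm; apply: le_trans (_ : opnorm (1%:M : 'M[R[i]]_(r * q)) * mxnorm x *
    mxnorm y * opnorm (1%:M : 'M[R[i]]_(r * q)) <= _).
  apply: inf_lbound.
    exists 0 => _ [p' [q' [a [x' [y' [c [_ ->]]]]]]].
    by rewrite !mulr_ge0 ?opnorm_ge0 ?mxnorm_ge0.
  exists r, q, 1%:M, x, y, 1%:M; split=> //; rewrite sE.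
  by rewrite mxact1.
have o1 : opnorm (1%:M : 'M[R[i]]_(r * q)) <= 1.
  by apply: opnorm_le => // v; rewrite mul1mx mul1r.
rewrite -[leRHS]mulr1 ler_pM ?mulr_ge0 ?opnorm_ge0 ?mxnorm_ge0 //.
by rewrite ler_wpM2r ?mxnorm_ge0 // ler_piMl ?mxnorm_ge0.
Qed.

Section Extension.
Variables (Z : opSpaceType R) (b : X -> Y -> Z) (K : R).
Hypotheses (K0 : 0 <= K) (hb : is_bilinear b)
  (bK : forall r s (x : 'M[X]_r) (y : 'M[Y]_s),
    mxnorm (bimx b x y) <= K * mxnorm x * mxnorm y).
Notation S' := (tens_sum b).

Let mxS n (s : 'M[seq (X * Y)]_n) : mxnorm (map_mx S' s) <= K * mxnorm (map_mx S s).
Proof.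
have main p q (a : 'M_(n, p * q)) (x : 'M[X]_p) (y : 'M[Y]_q) (c : 'M_(p * q, n)) :
    map_mx S s = mxact a (bimx tens x y) c -> map_mx S' s = mxact a (bimx b x y) c.
  move=> h; apply/matrixP => i j; move/matrixP/(_ i j): h; rewrite !mxE => h.
  pose f k l : X * Y := (bimx (fun x y => (x, y)) x y) k l.
  pose r := flatten [seq flatten [seq lscale (a i k * c l j) [:: f k l] | l <- enum 'I_(p * q)]
                    | k <- enum 'I_(p * q)].
  have rE (V : lmodType R[i]) (t : X -> Y -> V) : is_bilinear t ->
      tens_sum t r = \sum_k \sum_l (a i k * c l j) *: bimx t x y k l.
    move=> ht; rewrite /tens_sum big_flatten big_map big_enum /=; apply: eq_bigr => k _.
    rewrite big_flatten big_map big_enum /=; apply: eq_bigr => l _.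
    have := tens_sum_scale (a i k * c l j) [:: f k l] ht; rewrite /tens_sum => ->.
    by rewrite big_seq1 /f !mxE.
  have := @pt_alg _ _ _ T Z b hb (s i j ++ lscale (-1) r).
  have ht := pt_bilinear T; rewrite !tens_sum_cat !tens_sum_scale // !rE //.
  rewrite !scaleN1r h subrr => /(_ erefl) /eqP.
  by rewrite subr_eq0 => /eqP.
have [p0 [q0 [a0 [x0 [y0 [c0 h0]]]]]] := tens_rep_sum s (pt_bilinear T).
have : K = 0 \/ 0 < K by move: K0; rewrite le_eqVlt => /predU1P[<-|]; [left|right].
case=> [Kz|Kp].
  rewrite Kz mul0r (main _ _ _ _ _ _ h0); apply: le_trans (mxnorm_act _ _ _) _.
  have := bK x0 y0; rewrite Kz !mul0r => h; have -> : mxnorm (bimx b x0 y0) = 0.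
    by apply/eqP; rewrite eq_le h mxnorm_ge0.
  by rewrite mulr0 mul0r.
rewrite -ler_pdivrMl // pt_norm; apply: lb_le_inf.
  by eexists; exists p0, q0, a0, x0, y0, c0; split; [exact: h0|reflexivity].
move=> _ [p [q [a [x [y [c [h ->]]]]]]]; rewrite ler_pdivrMl // (main _ _ _ _ _ _ h).
apply: le_trans (mxnorm_act _ _ _) _; rewrite !mulrA ler_wpM2r ?opnorm_ge0 //.
by rewrite [K * _]mulrC -!mulrA ler_wpM2l ?opnorm_ge0 // mulrA bK.
Qed.

Let S_S' (s : seq (X * Y)) : vnorm (S' s) <= K * vnorm (S s).
Proof.
by have := mxS (const_mx s : 'M_1); rewrite !map_const_mx.
Qed.

Let S_sub (V : lmodType R[i]) (t : X -> Y -> V) s s' : is_bilinear t ->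
  tens_sum t (s ++ lscale (-1) s') = tens_sum t s - tens_sum t s'.
Proof. by move=> ht; rewrite tens_sum_cat tens_sum_scale // scaleN1r. Qed.

Let S_subS s s' : vnorm (S' s - S' s') <= K * vnorm (S s - S s').
Proof. by have := S_S' (s ++ lscale (-1) s'); rewrite !S_sub //; exact: pt_bilinear. Qed.

Let K1 : 0 < K + 1. Proof. by rewrite ltr_wpDl. Qed.

Let S'_cvg (s s' : nat -> seq (X * Y)) u z :
  vcvg (S \o s) u -> vcvg (S \o s') u -> vcvg (S' \o s) z -> vcvg (S' \o s') z.
Proof.
move=> hs hs' hz e e0; have e2 := divr_gt0 e0 (ltr0n R 2).
have e3 := divr_gt0 (divr_gt0 e2 (ltr0n R 2)) K1.
have [N1 h1] := hs _ e3; have [N2 h2] := hs' _ e3; have [N3 h3] := hz _ e2.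
exists (maxn N1 (maxn N2 N3)) => n; rewrite !geq_max => /and3P[n1 n2 n3] /=.
apply: le_lt_trans (vnorm_telescope _ _ (S' (s n))) _; rewrite (splitr e); apply: ltrD; last exact: h3.
apply: le_lt_trans (S_subS _ _) _.
have := h1 n n1; have := h2 n n2 => /= a1 a2.
have : vnorm (S (s' n) - S (s n)) < e / 2 / (K + 1).
  apply: le_lt_trans (vnorm_telescope _ _ u) _; rewrite [vnorm (u - _)]vnormB.
  have -> : e / 2 / (K + 1) = e / 2 / 2 / (K + 1) + e / 2 / 2 / (K + 1).
    by rewrite -mulrDl -splitr.
  exact: ltrD.
rewrite ltr_pdivlMr //; apply: le_lt_trans; rewrite mulrC ler_wpM2l ?vnorm_ge0 //.
by rewrite lerDl.
Qed.

Lemma tens_extend :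
  exists2 f : cbMap T Z, (forall x y, f (tens x y) = b x y) & cb_bound f K.
Proof.
have /choice[s hs] : forall u : T, exists s : nat -> seq (X * Y), vcvg (S \o s) u.
  move=> u; have /choice[s hs] : forall k, exists s, vnorm (u - S s) < (2^-1 : R) ^+ k.
    by move=> k; apply: pt_dense; rewrite exprn_gt0 // invr_gt0 ltr0n.
  exists s => e e0; have [N hN] := geo_small e0; exists N => n Nn /=.
  by rewrite vnormB; apply: lt_trans (hs n) (hN n Nn).
have /choice[f hf] : forall u : T, exists z, vcvg (S' \o s u) z.
  move=> u; apply: vcomplete => e e0.
  have e1 := divr_gt0 e0 K1; have e2 := divr_gt0 e1 (ltr0n R 2).
  have [N hN] := hs u _ e2; exists N => m n Nm Nn /=.
  apply: le_lt_trans (S_subS _ _) _.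
  have : vnorm (S (s u m) - S (s u n)) < e / (K + 1).
    apply: le_lt_trans (vnorm_telescope _ _ u) _; rewrite [vnorm (u - _)]vnormB (splitr (e / _)).
    by apply: ltrD; exact: hN.
  rewrite ltr_pdivlMr //; apply: le_lt_trans; rewrite mulrC ler_wpM2l ?vnorm_ge0 //.
  by rewrite lerDl.
have fE u s' z : vcvg (S \o s') u -> vcvg (S' \o s') z -> f u = z.
  by move=> h h'; apply: (vcvg_uniq (hf u)); exact: S'_cvg h (hs u) h'.
have fl : linear f.
  move=> c u v; apply: (fE _ (fun n => lscale c (s u n) ++ s v n)).
    have -> : S \o (fun n => lscale c (s u n) ++ s v n) = (fun n => c *: S (s u n) + S (s v n)).
      by apply: funext => n /=; rewrite tens_sum_cat tens_sum_scale //; exact: pt_bilinear.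
    apply: vcvgD; [apply: vcvgZ|]; exact: hs.
  have -> : S' \o (fun n => lscale c (s u n) ++ s v n) = (fun n => c *: S' (s u n) + S' (s v n)).
    by apply: funext => n /=; rewrite tens_sum_cat tens_sum_scale.
  apply: vcvgD; [apply: vcvgZ|]; exact: hf.
have fK : cb_bound f K.
  move=> n u; apply/ler_addgt0Pl => e e0; have e1 := divr_gt0 e0 K1.
  pose sg k := \matrix_(i, j) s (u i j) k : 'M[seq (X * Y)]_n.
  have sgu i j : vcvg (fun k => map_mx S (sg k) i j) (u i j).
    by move=> d d0; have [N hN] := hs (u i j) d d0; exists N => k Nk; rewrite !mxE; exact: hN.
  have [N hN] := mx_cvg sgu e1.
  apply: (@mx_cvg_bound _ _ _ (fun k => map_mx S' (sg (k + N)%N))).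
    move=> i j d d0; have [M hM] := hf (u i j) d d0; exists M => k Mk; rewrite !mxE.
    by apply: hM; rewrite (leq_trans Mk) ?leq_addr.
  move=> k; apply: le_trans (mxS _) _.
  have hk := hN (k + N)%N (leq_addl _ _).
  rewrite -[map_mx S _](subrK u) addrC.
  apply: (@le_trans _ _ (K * (mxnorm u + e / (K + 1)))).
    by rewrite ler_wpM2l //; apply: le_trans (mxnormD _ _) _; rewrite lerD2l ltW.
  rewrite mulrDr addrC lerD2r mulrCA ler_piMr ?ltW // ltr_pdivrMr // mul1r.
  by rewrite ltrDl.
exists (CBMap (cb_mkP fl fK)) => // x y /=.
apply: (fE _ (fun=> [:: (x, y)])).
  by move=> e e0; exists 0%N => n _; rewrite /= /tens_sum big_seq1 subrr vnorm0.
by move=> e e0; exists 0%N => n _; rewrite /= /tens_sum big_seq1 subrr vnorm0.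
Qed.

Lemma tens_ext_uniq (f g : cbMap T Z) :
  (forall x y, f (tens x y) = g (tens x y)) -> f = g.
Proof.
move=> fg; apply/eqP; rewrite -subr_eq0; apply/eqP; apply: cbMap_eq => u; rewrite cb0E.
have SE s : (f - g) (S s) = 0.
  by rewrite /tens_sum linear_sum big1 // => p _ /=; apply/eqP; rewrite subr_eq0 fg.
apply: vnorm_lim0 => e e0.
have M1 : 0 < vnorm (f - g) + 1 by rewrite ltr_wpDl ?vnorm_ge0.
have [s hs] := pt_dense u (divr_gt0 e0 M1).
have -> : (f - g) u = (f - g) (u - S s).
  exact/esym/(etrans (linearB (f - g) u (S s)))/(etrans (congr1 (fun z => (f - g) u - z) (SE s)) (subr0 _)).
apply: le_lt_trans (cb_apply_vnorm _ _) _; move: hs; rewrite ltr_pdivlMr //.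
by apply: le_lt_trans; rewrite mulrC ler_wpM2l ?vnorm_ge0 // lerDl.
Qed.

End Extension.

End TensorExtension.

Section TensorLift.
Variables (R : realType) (X Y Z : opSpaceType R).

Definition jcb (b : X -> Y -> Z) : Prop :=
  is_bilinear b /\ exists2 K, 0 <= K & forall r s (x : 'M[X]_r) (y : 'M[Y]_s),
    mxnorm (bimx b x y) <= K * mxnorm x * mxnorm y.

Lemma cc_jcb b : cc_bilinear b -> jcb b.
Proof. by move=> [bl hb]; split=> //; exists 1 => // r s x y; rewrite mul1r. Qed.

Variables (T : projTensor X Y) (b : X -> Y -> Z) (hb : jcb b).

Lemma tens_lift_ex : exists f : cbMap T Z, forall x y, f (pt_tens T x y) = b x y.
Proof.
have [bl [K K0 bK]] := hb.
by have [f hf _] := tens_extend T K0 bl bK; exists f.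
Qed.

(* uniquely determined by tens_liftE, by tens_ext_uniq *)
Definition tens_lift : cbMap T Z := projT1 (cid tens_lift_ex).

Lemma tens_liftE x y : tens_lift (pt_tens T x y) = b x y.
Proof. exact: projT2 (cid tens_lift_ex) x y. Qed.

Lemma tens_lift_bound (K : R) : 0 <= K ->
  (forall r s (x : 'M[X]_r) (y : 'M[Y]_s), mxnorm (bimx b x y) <= K * mxnorm x * mxnorm y) ->
  cb_bound tens_lift K.
Proof.
move=> K0 bK; have [f fE fK] := tens_extend T K0 hb.1 bK.
suff -> : tens_lift = f by [].
by apply: (@tens_ext_uniq _ _ _ T) => x y; rewrite tens_liftE fE.
Qed.

End TensorLift.

Section ImageMaps.
Variables (R : realType) (T V Z : opSpaceType R) (P : cbMap T V).

Lemma im_proj_cb : im_proj P \in @cb_pred _ T (cbImage P).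
Proof.
apply: (@cb_mkP _ _ _ _ 1) => [c x y|n u].
  by apply: val_inj; rewrite /= linearP.
by rewrite mul1r; apply: im_mxnorm_lb; apply/matrixP => i j; rewrite !mxE.
Qed.

Definition im_projcb : cbMap T (cbImage P) := CBMap im_proj_cb.

Lemma im_factor (h : cbImage P -> Z) (g : cbMap T Z) :
  (forall u, h (im_proj P u) = g u) -> h \in @cb_pred _ (cbImage P) Z.
Proof.
move=> hg; have [M M0 gM] := cb_bounded g.
apply: (@cb_mkP _ _ _ _ M) => [c v w|n v].
  have [x ->] := im_projP v; have [y ->] := im_projP w.
  rewrite -[_ *: _ + _](linearP im_projcb) /= !hg; exact: linearP.
apply: im_mxnorm_ge => // u hu; apply: le_trans (gM n u).
rewrite le_eqVlt; apply/orP; left; apply/eqP; congr mxnorm; apply/matrixP => i j.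
rewrite !mxE -hg; congr h; apply: val_inj; by move/matrixP/(_ i j): hu; rewrite !mxE.
Qed.

End ImageMaps.

Section Algebras.
Variable R : realType.

(* completely contractive Banach algebras, not assumed unital *)
Record ccAlgebra := CCAlgebra {
  alg_space :> opSpaceType R;
  alg_mul : alg_space -> alg_space -> alg_space;
  alg_mul_cc : cc_bilinear alg_mul;
  alg_mulA : associative alg_mul
}.

Record ccRightModule (A : ccAlgebra) := CCRightModule {
  rmod_space :> opSpaceType R;
  rmod_act : rmod_space -> A -> rmod_space;
  rmod_act_cc : cc_bilinear rmod_act;
  rmod_actA : forall x a b, rmod_act (rmod_act x a) b = rmod_act x (alg_mul a b)
}.

Definition cc_left_module (B Y : opSpaceType R) (mul : B -> B -> B) (act : B -> Y -> Y) : Prop :=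
  cc_bilinear act /\ forall b c y, act (mul b c) y = act b (act c y).

End Algebras.

Arguments alg_mul {R A} : rename.
Arguments rmod_act {R A X} : rename.

(* X^* with the weak* topology, that of pointwise convergence on X *)
Definition weakstar (R : realType) (X : opSpaceType R) : Type := odual X.

HB.instance Definition _ (R : realType) (X : opSpaceType R) :=
  Topological.copy (weakstar X)
    (initial_topology (fun f : odual X => (f : X -> R[i]^o) : {ptws X -> R[i]^o})).

Section Fourier.
Variables (R : realType) (A : ccAlgebra R) (X : ccRightModule A).

(* <x^* . x, a> = <x^*, x . a> *)
Definition coeff (f : odual X) (x : X) : odual A := adjoint (rmod_act_cc X) f x.

Lemma coeffE f x a : coeff f x a = f (rmod_act x a).
Proof. by []. Qed.

(* <a . x^*, x> = <x^*, x . a> *)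
Definition dual_act (a : A) (f : odual X) : odual X := adjoint (cc_flip (rmod_act_cc X)) f a.

Lemma dual_actE a f x : dual_act a f x = f (rmod_act x a).
Proof. by []. Qed.

Lemma dual_act_cc : cc_bilinear dual_act.
Proof. exact/cc_flip/adjoint_cc. Qed.

Definition GammaQ (a : A) : cbMap (odual X) (odual X) := cc_left dual_act_cc a.

Lemma GammaQE a f : GammaQ a f = dual_act a f.
Proof. by []. Qed.

(* <phi . a, b> = <phi, a b> *)
Definition predual_act (phi : odual A) (a : A) : odual A := adjoint (alg_mul_cc A) phi a.

Lemma predual_actE phi a b : predual_act phi a b = phi (alg_mul a b).
Proof. by []. Qed.

Variable T : projTensor (odual X) X.

Definition PQ : cbMap T (odual A) := tens_lift T (cc_jcb (adjoint_cc (rmod_act_cc X))).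

Lemma PQE f x : PQ (pt_tens T f x) = coeff f x.
Proof. exact: tens_liftE. Qed.

Definition FQ : opSpaceType R := cbImage PQ.

(* x^* . x = P(x^* (x) x), as an element of F_Q(A^* ) *)
Definition FQ_coeff (f : odual X) (x : X) : FQ := im_proj PQ (pt_tens T f x).

Lemma FQ_coeffE f x : im_val (FQ_coeff f x) = coeff f x.
Proof. exact: PQE. Qed.

Lemma FQ_coeff_cc : cc_bilinear FQ_coeff.
Proof.
have [[tl tr] hT] := tens_bimx_cc T.
split.
  split=> [f c x y|x c f g]; rewrite /FQ_coeff.
    by rewrite tl; exact: (linearP (im_projcb PQ)).
  by have /= -> := tr x c f g; exact: (linearP (im_projcb PQ)).
move=> r s f x; apply: le_trans (hT r s f x).
by apply: im_mxnorm_lb; apply/matrixP => i j; rewrite !mxE.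
Qed.

(* <mu . x^*, x> = <mu, x^* . x> *)
Definition FQ_act (mu : odual FQ) (f : odual X) : odual X := adjoint FQ_coeff_cc mu f.

Lemma FQ_actE mu f x : FQ_act mu f x = mu (FQ_coeff f x).
Proof. by []. Qed.

Lemma FQ_act_cc : cc_bilinear FQ_act.
Proof. exact: adjoint_cc. Qed.

Lemma shift_jcb a : jcb (fun f x => pt_tens T f (rmod_act x a)).
Proof.
have [[tl tr] hT] := tens_bimx_cc T; have hr := cc_flip (rmod_act_cc X).
split.
  split=> [f c x y|x c f g]; last exact: tr.
  by rewrite (hr.1.1 a c x y) tl.
exists (vnorm a) => [|r s f x]; first exact: vnorm_ge0.
have -> : bimx (fun f x => pt_tens T f (rmod_act x a)) f x =
    bimx (@pt_tens _ _ _ T) f (map_mx (rmod_act^~ a) x).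
  by apply/matrixP => i j; rewrite !mxE.
apply: le_trans (hT _ _ _ _) _; rewrite [vnorm a * _]mulrC -mulrA ler_wpM2l ?mxnorm_ge0 //.
exact: (cc_left_bound hr a x).
Qed.

Lemma PQ_shift a u :
  PQ (tens_lift T (shift_jcb a) u) = predual_act (PQ u) a.
Proof.
pose g : cbMap (odual A) (odual A) := cc_left (cc_flip (adjoint_cc (alg_mul_cc A))) a.
suff E : cb_comp PQ (tens_lift T (shift_jcb a)) = cb_comp g PQ.
  by have := congr1 (fun h : cbMap T (odual A) => h u) E.
apply: (@tens_ext_uniq _ _ _ T) => f x; rewrite /= tens_liftE !PQE.
by apply: cbMap_eq => b; rewrite coeffE /= rmod_actA.
Qed.

Lemma FQ_ract_proof (phi : FQ) a : predual_act (im_val phi) a \in im_pred PQ.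
Proof.
have [u ->] := im_projP phi; apply/asboolP.
by exists (tens_lift T (shift_jcb a) u); rewrite PQ_shift.
Qed.

Definition FQ_ract (phi : FQ) (a : A) : FQ := CBImage (FQ_ract_proof phi a).

Lemma FQ_ractE phi a : im_val (FQ_ract phi a) = predual_act (im_val phi) a.
Proof. by []. Qed.

Lemma FQ_ract_proj u a : FQ_ract (im_proj PQ u) a = im_proj PQ (tens_lift T (shift_jcb a) u).
Proof. by apply: val_inj; rewrite /= PQ_shift. Qed.

Lemma slice_jcb (nu : odual FQ) : jcb (fun f x => pt_tens T (FQ_act nu f) x).
Proof.
have [[tl tr] hT] := tens_bimx_cc T.
split.
  split=> [f|x c f g]; first exact: tl.
  by rewrite (FQ_act_cc.1.1 nu c f g); exact: tr.
exists (vnorm nu) => [|r s f x]; first exact: vnorm_ge0.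
have -> : bimx (fun f x => pt_tens T (FQ_act nu f) x) f x =
    bimx (@pt_tens _ _ _ T) (map_mx (FQ_act nu) f) x.
  by apply/matrixP => i j; rewrite !mxE.
apply: le_trans (hT _ _ _ _) _; rewrite ler_wpM2r ?mxnorm_ge0 //.
exact: (cc_left_bound FQ_act_cc nu f).
Qed.

Lemma slice_projE (nu : odual FQ) u a :
  PQ (tens_lift T (slice_jcb nu) u) a = nu (FQ_ract (im_proj PQ u) a).
Proof.
rewrite FQ_ract_proj.
pose ev : cbMap (odual A) R[i]^o := cc_left (cc_flip (@cb_eval_cc R A R[i]^o)) a.
suff E : cb_comp ev (cb_comp PQ (tens_lift T (slice_jcb nu))) =
    cb_comp nu (cb_comp (im_projcb PQ) (tens_lift T (shift_jcb a))).
  by have := congr1 (fun h : cbMap T R[i]^o => h u) E.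
apply: (@tens_ext_uniq _ _ _ T) => f x /=; by rewrite !tens_liftE.
Qed.

Lemma lbox_ex (nu : odual FQ) (phi : FQ) :
  exists psi : FQ, forall a, im_val psi a = nu (FQ_ract phi a).
Proof.
have [u ->] := im_projP phi; exists (im_proj PQ (tens_lift T (slice_jcb nu) u)) => a.
exact: slice_projE.
Qed.

(* nu [] phi, the element of F_Q(A^* ) with <nu [] phi, a> = <nu, phi . a> *)
Definition lbox (nu : odual FQ) (phi : FQ) : FQ := projT1 (cid (lbox_ex nu phi)).

Lemma lboxE nu phi a : im_val (lbox nu phi) a = nu (FQ_ract phi a).
Proof. exact: projT2 (cid (lbox_ex nu phi)) a. Qed.

Lemma box_proof (mu nu : odual FQ) :
  (fun phi : FQ => mu (lbox nu phi)) \in @cb_pred _ FQ R[i]^o.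
Proof.
apply: (@im_factor _ _ _ _ PQ _
  (cb_comp mu (cb_comp (im_projcb PQ) (tens_lift T (slice_jcb nu))))) => u /=.
congr (mu _); apply: val_inj; apply: cbMap_eq => a /=.
by rewrite lboxE slice_projE.
Qed.

(* <mu [] nu, phi> = <mu, nu [] phi> *)
Definition box (mu nu : odual FQ) : odual FQ := CBMap (box_proof mu nu).

Lemma boxE mu nu phi : box mu nu phi = mu (lbox nu phi).
Proof. by []. Qed.

Lemma etaQ_proof (a : A) : (fun phi : FQ => im_val phi a) \in @cb_pred _ FQ R[i]^o.
Proof.
pose ev : cbMap (odual A) R[i]^o := cc_left (cc_flip (@cb_eval_cc R A R[i]^o)) a.
by apply: (@im_factor _ _ _ _ PQ _ (cb_comp ev PQ)).
Qed.

(* <eta_Q(a), phi> = <phi, a> *)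
Definition etaQ (a : A) : odual FQ := CBMap (etaQ_proof a).

Lemma etaQE a phi : etaQ a phi = im_val phi a.
Proof. by []. Qed.

Definition breveGammaQ (mu : odual FQ) : cbMap (odual X) (odual X) := cc_left FQ_act_cc mu.

Lemma breveGammaQE mu f : breveGammaQ mu f = FQ_act mu f.
Proof. by []. Qed.

Lemma pairing_jcb (S : cbMap (odual X) (odual X)) : jcb (fun f x => S f x : R[i]^o).
Proof.
split; first by split=> [f|x c f g]; [exact: linearP|rewrite linearP].
exists (vnorm S) => [|r s f x]; first exact: vnorm_ge0.
have -> : bimx (fun f x => S f x : R[i]^o) f x = bimx (@cb_eval _ X R[i]^o) (map_mx S f) x.
  by apply/matrixP => i j; rewrite !mxE.
apply: le_trans (cb_mxnorm_ub _ _) _; rewrite ler_wpM2r ?mxnorm_ge0 //.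
exact: cb_vnorm_bound.
Qed.

(* CB(X^* ) = (X^* (x) X)^*, <S, x^* (x) x> = <S x^*, x> *)
Definition cb_pairing (S : cbMap (odual X) (odual X)) : weakstar T := tens_lift T (pairing_jcb S).

Lemma cb_pairingE S f x : (cb_pairing S : odual T) (pt_tens T f x) = S f x.
Proof. exact: tens_liftE. Qed.

Definition weakstar_CB : Type := initial_topology cb_pairing.

HB.instance Definition _ := Topological.copy weakstar_CB (initial_topology cb_pairing).

Definition MQ : set (cbMap (odual X) (odual X)) :=
  @closure weakstar_CB (range GammaQ).

End Fourier.

(* Main.v *)
(* Under CB(X^* ) = (X^* (x) X)^*, the map breve Gamma_Q is the adjoint of the
   quotient map X^* (x) X -> F_Q(A^* ) = (X^* (x) X) / ker P, so it is a complete
   isometry with range the annihilator of ker P.  Gamma_Q(A) lies in that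
   annihilator, which is weak*-closed.  Conversely, given mu and finitely many
   tensors u_i, finite-dimensional linear algebra yields a in A with
   <P u_i, a> = <mu, P u_i> for every i, because a linear relation among the
   functionals P u_i on A is a relation in F_Q(A^* ), hence holds for the numbers
   <mu, P u_i>; so breve Gamma_Q(mu) is a weak* limit of elements Gamma_Q(a). *)
From HB Require Import structures.
Require Import Defs.
From mathcomp Require Import all_boot all_order all_algebra complex mxtens.
From mathcomp Require Import boolp classical_sets functions reals topology normedtype.

Set Implicit Arguments.
Unset Strict Implicit.
Unset Printing Implicit Defensive.

Import Order.TTheory GRing.Theory Num.Theory numFieldNormedType.Exports.

Local Open Scope classical_set_scope.
Local Open Scope ring_scope.

(* Enlarging a matrix of values of maximal rank does not enlarge its row space,
   which therefore contains the range of [g]; [cokermx] supplies the functionals [c]. *)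
Lemma linear_row_surj (K : fieldType) (V : lmodType K) k
    (g : {linear V -> 'rV[K]_k}) (y : 'rV[K]_k) :
  (forall c : 'cV[K]_k, (forall v, g v *m c = 0) -> y *m c = 0) ->
  exists v, g v = y.
Proof.
move=> hy.
pose M N (s : 'I_N -> V) : 'M_(N, k) := \matrix_i g (s i).
pose P r := `[< exists N (s : 'I_N -> V), \rank (M N s) = r >].
have exP : exists r, P r.
  by exists (\rank (M 0%N (fun _ => 0))); apply/asboolP; exists 0%N, (fun _ => 0).
have ubP r : P r -> (r <= k)%N by move=> /asboolP[N [s <-]]; exact: rank_leq_col.
case: (ex_maxnP exP ubP) => _ /asboolP[N [s <-]] maxs.
have gM v : (g v <= M N s)%MS.
  pose s' (i : 'I_(N + 1)) := if fintype.split i is inl j then s j else v.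
  have s'E : M _ s' = col_mx (M N s) (g v).
    apply/row_matrixP => i; rewrite rowK /s'; case: (split_ordP i) => j ->.
      by rewrite rowKu rowK.
    by rewrite rowKd row_id.
  have sub : (M N s <= col_mx (M N s) (g v))%MS.
    by have := submx_refl (col_mx (M N s) (g v)); rewrite {1}col_mx_sub => /andP[].
  have : (col_mx (M N s) (g v) <= M N s)%MS.
    rewrite -(mxrank_leqif_sup sub) eqn_leq mxrankS //= -s'E.
    by apply: maxs; apply/asboolP; exists (N + 1)%N, s'.
  by rewrite col_mx_sub => /andP[].
have /submxP[d ->] : (y <= M N s)%MS.
  rewrite submxE; apply/eqP/matrixP => i j; rewrite [RHS]mxE.
  have /matrixP/(_ i 0) : y *m col j (cokermx (M N s)) = 0.
    apply: hy => v; have := gM v; rewrite submxE => /eqP h.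
    by rewrite colE mulmxA h mul0mx.
  by rewrite colE mulmxA -colE !mxE.
exists (\sum_i d 0 i *: s i); rewrite linear_sum mulmx_sum_row.
by apply: eq_bigr => i _; rewrite linearZ rowK.
Qed.

(** * Convergence in initial, pointwise and weak* topologies *)

Lemma initial_cvg (S : choiceType) (T : topologicalType) (f : S -> T)
    (F : set_system S) (s : S) : Filter F ->
  f @ F --> f s -> F --> (s : initial_topology f).
Proof.
move=> FF Ffs A [_ [[B oB <-] Bs BA]].
by apply: (filterS BA); exact: Ffs (open_nbhs_nbhs (conj oB Bs)).
Qed.

(** The pointwise topology is the supremum of the initial topologies of the evaluations. *)
Lemma cvg_ptws (U : Type) (V : topologicalType) (F : set_system (U -> V)) (f : U -> V) :
  Filter F -> (forall t, (fun g => g t) @ F --> f t) -> {ptws, F --> f}.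
Proof. by move=> FF Ff; apply/cvg_sup => t; exact: initial_cvg. Qed.

Section WeakStar.
Variables (R : realType) (Y : opSpaceType R).

Lemma weakstar_eval_continuous (y : Y) :
  continuous ((fun mu => (mu : odual Y) y) : weakstar Y -> R[i]^o).
Proof.
move=> mu.
have := @continuous_comp _ _ _ _ (fun g : {ptws Y -> R[i]^o} => g y) mu
  (@initial_continuous _ _ _ _) (@proj_continuous _ _ y _).
exact.
Qed.

Lemma weakstar_cvg (F : set_system (odual Y)) (mu : odual Y) : Filter F ->
  (forall y, (fun nu : odual Y => nu y : R[i]^o) @ F --> (mu y : R[i]^o)) ->
  F --> (mu : weakstar Y).
Proof. by move=> FF h; apply: initial_cvg; exact: cvg_ptws. Qed.

End WeakStar.

(** The amplified matrix of maps sends [y] to [bimx b x y]. So currying a c.c. bilinear map is a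
    complete contraction, a bound at all matrix levels where [cc_left_bound] treats a single [x]. *)
Lemma cc_left_mxnorm (R : realType) (X Y Z : opSpaceType R) (b : X -> Y -> Z)
    (hb : cc_bilinear b) n (x : 'M[X]_n) :
  mxnorm (map_mx (cc_left hb) x) <= mxnorm x.
Proof.
apply: cb_mxnorm_le => [|m y]; first exact: mxnorm_ge0.
have -> : bimx (@cb_eval _ Y Z) (map_mx (cc_left hb) x) y = bimx b x y.
  by apply/matrixP => i j; rewrite !mxE.
exact: hb.2.
Qed.

(** * The duality between completely bounded maps and the projective tensor product *)

Section CBPredual.
Variables (R : realType) (X Y : opSpaceType R) (T : projTensor (odual X) Y).
Notation CB := (cbMap (odual X) (odual Y)).

Lemma dual_eval_cc : cc_bilinear (fun (y : Y) (f : odual Y) => f y : R[i]^o).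
Proof. exact: cc_flip (@cb_eval_cc R Y R[i]^o). Qed.

(** Composing evaluation at [f] with evaluation at [y] gives complete boundedness for free. *)
Definition matrix_coeff (f : odual X) (y : Y) : odual CB :=
  adjoint (cc_flip (@cb_eval_cc R (odual X) (odual Y))) (cc_left dual_eval_cc y) f.

Lemma matrix_coeffE f y S : matrix_coeff f y S = S f y.
Proof. by []. Qed.

Lemma matrix_coeff_cc : cc_bilinear matrix_coeff.
Proof.
split.
  split=> [f c x y|y c f g]; apply: cbMap_eq => S.
    by rewrite cbDE cbZE !matrix_coeffE linearP.
  by rewrite cbDE cbZE !matrix_coeffE linearP.
move=> r s f y.
have := (cc_flip (adjoint_cc (W := R[i]^o)
  (cc_flip (@cb_eval_cc R (odual X) (odual Y))))).2 r s f (map_mx (cc_left dual_eval_cc) y).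
have -> : bimx (fun y0 x => adjoint (cc_flip (@cb_eval_cc R (odual X) (odual Y))) x y0) f
    (map_mx (cc_left dual_eval_cc) y) = bimx matrix_coeff f y.
  by apply/matrixP => i j; rewrite !mxE.
move/le_trans; apply; rewrite ler_wpM2l ?mxnorm_ge0 //; exact: cc_left_mxnorm.
Qed.

(** The canonical map of the predual into the bidual. Taking values in functionals on [CB], it can
    be paired with whole matrices of maps. *)
Definition tens_pairing : cbMap T (odual CB) := tens_lift T (cc_jcb matrix_coeff_cc).

Lemma tens_pairingE f y S : tens_pairing (pt_tens T f y) S = S f y.
Proof. by rewrite /tens_pairing tens_liftE. Qed.

(** The lift of a c.c. bilinear map has completely bounded norm at most 1, so
    [map_mx tens_pairing u] is a matrix of functionals of norm at most that of [u]. The lower bound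
    for [breveGammaQ] rests on this. *)
Lemma tens_pairing_mxnorm m n (S : 'M[CB]_m) (u : 'M[T]_n) :
  mxnorm (bimx (fun S u => tens_pairing u S : R[i]^o) S u) <= mxnorm S * mxnorm u.
Proof.
apply: le_trans (bimx_flip (fun u S => tens_pairing u S : R[i]^o) u S) _.
have -> : bimx (fun u S => tens_pairing u S : R[i]^o) u S =
    bimx (@cb_eval _ CB R[i]^o) (map_mx tens_pairing u) S.
  by apply/matrixP => i j; rewrite !mxE.
apply: le_trans (cb_mxnorm_ub _ _) _; rewrite mulrC ler_wpM2l ?mxnorm_ge0 //.
rewrite -[leRHS]mul1r; apply: (@tens_lift_bound _ _ _ _ T) => // r s f y.
by rewrite mul1r; exact: matrix_coeff_cc.2.
Qed.

End CBPredual.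

(** * The pairing evaluated at the maps of the representation *)

Section Representation.
Variables (R : realType) (A : ccAlgebra R) (X : ccRightModule A).
Variable T : projTensor (odual X) X.

(** Both sides are bounded in [u] and agree on elementary tensors. This links the pairing that
    defines the weak* topology to the one that carries the matrix bound. *)
Lemma cb_pairing_tens (S : cbMap (odual X) (odual X)) u :
  (cb_pairing T S : odual T) u = tens_pairing T u S.
Proof.
pose ev : cbMap _ R[i]^o := cc_left (@dual_eval_cc R (cbMap (odual X) (odual X))) S.
suff -> : (cb_pairing T S : odual T) = cb_comp ev (tens_pairing T) by [].
apply: (@tens_ext_uniq _ _ _ T) => f x.
by rewrite cb_pairingE [RHS]tens_pairingE.
Qed.

(** [breveGammaQ] is thus the adjoint of the quotient map; on elementary tensors this is the
    definition of [FQ_act]. *)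
Lemma cb_pairing_breveGammaQ (mu : odual (FQ T)) u :
  (cb_pairing T (breveGammaQ mu) : odual T) u = mu (im_proj (PQ T) u).
Proof.
suff -> : (cb_pairing T (breveGammaQ mu) : odual T) = cb_comp mu (im_projcb (PQ T)) by [].
by apply: (@tens_ext_uniq _ _ _ T) => f x; rewrite cb_pairingE.
Qed.

Lemma cb_pairing_eq (S S' : cbMap (odual X) (odual X)) :
  (forall u, (cb_pairing T S : odual T) u = (cb_pairing T S' : odual T) u) -> S = S'.
Proof.
move=> h; apply: cbMap_eq => f; apply: cbMap_eq => x.
by have := h (pt_tens T f x); rewrite !cb_pairingE.
Qed.

(** * The module action and the complete isometry *)

(** Associativity of the right action gives $(x^*\cdot x)\cdot a=x^*\cdot(x\cdot a)$, and [nu] takes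
    there the value of $\nu\cdot x^*$ at $x\cdot a$. The module law follows. *)
Lemma lbox_coeff (nu : odual (FQ T)) f x :
  lbox nu (FQ_coeff T f x) = FQ_coeff T (FQ_act nu f) x.
Proof.
apply: val_inj; apply: cbMap_eq => a.
rewrite lboxE [RHS](congr1 (fun g : odual A => g a) (FQ_coeffE _ _ _)) coeffE FQ_actE.
congr (nu _); apply: val_inj; apply: cbMap_eq => b /=.
by rewrite !PQE !coeffE rmod_actA.
Qed.

Lemma FQ_act_box (mu nu : odual (FQ T)) f : FQ_act (box mu nu) f = FQ_act mu (FQ_act nu f).
Proof. by apply: cbMap_eq => x; rewrite !FQ_actE boxE lbox_coeff. Qed.

Lemma FQ_act_etaQ a f : FQ_act (etaQ T a) f = dual_act a f.
Proof. by apply: cbMap_eq => x; rewrite FQ_actE etaQE FQ_coeffE coeffE dual_actE. Qed.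

Lemma breveGammaQ_etaQ a : breveGammaQ (etaQ T a) = GammaQ X a.
Proof. by apply: cbMap_eq => f; rewrite breveGammaQE FQ_act_etaQ GammaQE. Qed.

Lemma breveGammaQ_linear : linear (@breveGammaQ R A X T).
Proof.
by move=> c mu nu; apply: cbMap_eq => f; exact: (FQ_act_cc T).1.2.
Qed.

(** The action is c.c., which gives one inequality. For the other, the values of [mu] at [v] are
    those of the pairing at any lift [u] of [v], and the infimum of the norms of the lifts is the
    norm of [v]. *)
Lemma breveGammaQ_mxnorm n (mu : 'M[odual (FQ T)]_n) :
  mxnorm (map_mx (@breveGammaQ R A X T) mu) = mxnorm mu.
Proof.
apply/eqP; rewrite eq_le cc_left_mxnorm /=.
apply: cb_mxnorm_le => [|m v]; first exact: mxnorm_ge0.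
apply: im_mxnorm_ge => [|u hu]; first exact: mxnorm_ge0.
apply: le_trans (tens_pairing_mxnorm _ _).
rewrite le_eqVlt; apply/orP; left; apply/eqP; congr mxnorm; apply/matrixP => i j.
rewrite !mxE -cb_pairing_tens cb_pairing_breveGammaQ /cb_eval; congr (mu _ _ _).
by apply: val_inj; move/matrixP/(_ (mxtens_unindex i).2 (mxtens_unindex j).2): hu; rewrite !mxE.
Qed.

Lemma breveGammaQ_inj : injective (@breveGammaQ R A X T).
Proof.
move=> mu nu h; apply: cbMap_eq => phi; have [u ->] := im_projP phi.
by rewrite -!cb_pairing_breveGammaQ h.
Qed.

(** * Weak* continuity *)

Lemma FQ_act_continuous f :
  continuous ((fun mu => FQ_act mu f) : weakstar (FQ T) -> weakstar X).
Proof.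
move=> mu; have FF := nbhs_filter (mu : weakstar (FQ T)).
apply: weakstar_cvg => x; exact: (@weakstar_eval_continuous _ (FQ T)).
Qed.

(** Paired with [u], the adjoint map becomes evaluation at [im_proj (PQ T) u]. *)
Lemma breveGammaQ_continuous :
  continuous (@breveGammaQ R A X T : weakstar (FQ T) -> weakstar_CB T).
Proof.
move=> mu; have FF := nbhs_filter (mu : weakstar (FQ T)).
apply: initial_cvg; apply: weakstar_cvg => u.
have := @weakstar_eval_continuous _ (FQ T) (im_proj (PQ T) u) mu.
have <- // : (fun nu : odual (FQ T) => (cb_pairing T (breveGammaQ nu) : odual T) u : R[i]^o) =
    (fun nu => nu (im_proj (PQ T) u)).
by apply: funext => nu; exact: cb_pairing_breveGammaQ.
Qed.

(** * The range as a weak* closure *)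

Lemma cb_pairing_GammaQ a u :
  (cb_pairing T (GammaQ X a) : odual T) u = (PQ T u : odual A) a.
Proof. by rewrite -breveGammaQ_etaQ cb_pairing_breveGammaQ. Qed.

Lemma cb_pairing_continuous u :
  continuous ((fun S => (cb_pairing T S : odual T) u) : weakstar_CB T -> R[i]^o).
Proof.
move=> S; apply: (@continuous_comp _ _ _ (cb_pairing T : weakstar_CB T -> weakstar T)
  (fun phi => (phi : odual T) u)); first exact: initial_continuous.
exact: weakstar_eval_continuous.
Qed.

(** Pairing with such a [u] is weak*-continuous and vanishes on the range of [GammaQ], hence on its
    closure. *)
Lemma MQ_kernel S u : MQ T S -> PQ T u = 0 -> (cb_pairing T S : odual T) u = 0.
Proof.
rewrite /MQ closureEcvg => -[G PG [GS rG]] u0.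
apply: (@cvg_unique _ (@norm_hausdorff _ _) (((fun S => (cb_pairing T S : odual T) u : R[i]^o)) @ G)).
  by apply: cvg_trans (@cb_pairing_continuous u S); exact: cvg_app.
apply: cvg_near_cst; apply: rG => _ [a _ <-].
by rewrite cb_pairing_GammaQ u0.
Qed.

Lemma MQ_sub_breveGammaQ S : MQ T S -> exists mu : odual (FQ T), breveGammaQ mu = S.
Proof.
move=> MS; have [h hS] : exists h : FQ T -> R[i]^o,
    forall u, h (im_proj (PQ T) u) = (cb_pairing T S : odual T) u.
  have /choice[s hs] := @im_projP _ _ _ (PQ T).
  (* The choice of the lift [s phi] is immaterial: two lifts differ by an element of the kernel of
     [PQ T], which [MQ_kernel] handles. *)
  exists (fun phi => (cb_pairing T S : odual T) (s phi)) => u.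
  apply/eqP; rewrite -subr_eq0 -linearB; apply/eqP; apply: MQ_kernel MS _.
  have := congr1 val (hs (im_proj (PQ T) u)) => /= e.
  by rewrite linearB /= -e subrr.
exists (CBMap (im_factor hS)); apply: cb_pairing_eq => u.
by rewrite cb_pairing_breveGammaQ.
Qed.

Lemma etaQ_interpolation (mu : odual (FQ T)) (s : seq T) :
  exists a, {in s, forall u, (PQ T u : odual A) a = mu (im_proj (PQ T) u)}.
Proof.
pose n := size s.
pose g (a : A) : 'rV[R[i]]_n := \row_i (PQ T s`_i : odual A) a.
have gl : linear g.
  by move=> c a b; apply/rowP => i; rewrite !mxE linearP.
pose gL : {linear A -> 'rV[R[i]]_n} := HB.pack g (GRing.isLinear.Build _ _ _ _ g gl).
have [c hc|a ha] := @linear_row_surj _ _ _ gL (\row_i mu (im_proj (PQ T) s`_i)).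
  (* The column [c] is a linear relation among the functionals [PQ T] of the tensors in [s]. It says
     that [w] dies in the quotient, so [mu] respects the relation. *)
  pose w := \sum_i c i 0 *: s`_i.
  have w0 : im_proj (PQ T) w = 0.
    apply: val_inj; apply: cbMap_eq => a /=.
    have /matrixP/(_ 0 0) := hc a; rewrite !mxE => e.
    rewrite /w linear_sum cb_sumE -[RHS]e; apply: eq_bigr => i _.
    by rewrite linearZ cbZE mxE mulrC.
  apply/matrixP => i j; rewrite !ord1 !mxE.
  transitivity (mu (im_proj (PQ T) w)); last by rewrite w0 linear0.
  rewrite -[RHS]/(cb_comp mu (im_projcb (PQ T)) w) /w linear_sum; apply: eq_bigr => k _.
  by rewrite linearZ mxE mulrC.
exists a => u us; have us' : (index u s < n)%N by rewrite index_mem.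
by have /rowP/(_ (Ordinal us')) := ha; rewrite !mxE /= nth_index.
Qed.

(* Indexed by the finite sets of tensors, the sets [B s] of interpolants generate
   a filter on the range of Gamma_Q converging weak* to [breveGammaQ mu]. *)
Lemma breveGammaQ_MQ (mu : odual (FQ T)) : MQ T (breveGammaQ mu).
Proof.
pose B (s : seq T) : set (cbMap (odual X) (odual X)) :=
  [set GammaQ X a | a in [set a | {in s, forall u, (PQ T u : odual A) a = mu (im_proj (PQ T) u)}]].
pose G := filter_from setT B.
have FG : ProperFilter G.
  apply: filter_from_proper; last first.
    by move=> s _; have [a ha] := etaQ_interpolation mu s; exists (GammaQ X a), a.
  apply: filter_from_filter; first by exists [::].
  move=> s t _ _; exists (s ++ t) => // _ [a ha <-].
  by split; exists a => // u us; apply: ha; rewrite mem_cat us ?orbT.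
rewrite /MQ closureEcvg; exists G => //; split; last first.
  by move=> D hD; exists [::] => // _ [a _ <-]; apply: hD; exists a.
apply: initial_cvg; apply: weakstar_cvg => u; apply: cvg_near_cst.
exists [:: u] => // _ [a ha <-] /=.
by rewrite cb_pairing_breveGammaQ cb_pairing_GammaQ ha // mem_head.
Qed.

End Representation.

Theorem theorem4p2 (R : realType) (A : ccAlgebra R) (X : ccRightModule A)
    (T : projTensor (odual X) X) :
  (* (a) *)
  [/\ cc_left_module (@box R A X T) (@FQ_act R A X T),
      forall f : odual X,
        continuous ((fun mu => FQ_act mu f) : weakstar (FQ T) -> weakstar X) &
      forall (a : A) (f : odual X), FQ_act (etaQ T a) f = dual_act a f] /\
  (* (b) *)
  [/\ continuous (@breveGammaQ R A X T : weakstar (FQ T) -> weakstar_CB T),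
      forall n (mu : 'M[odual (FQ T)]_n),
        mxnorm (map_mx (@breveGammaQ R A X T) mu) = mxnorm mu,
      linear (@breveGammaQ R A X T) /\
        (forall mu nu : odual (FQ T),
          breveGammaQ (box mu nu) = cb_comp (breveGammaQ mu) (breveGammaQ nu)),
      set_bij [set: odual (FQ T)] (MQ T) (@breveGammaQ R A X T) &
      forall a : A, breveGammaQ (etaQ T a) = GammaQ X a].
Proof.
split; split.
- by split; [exact: FQ_act_cc|exact: FQ_act_box].
- exact: FQ_act_continuous.
- exact: FQ_act_etaQ.
- exact: breveGammaQ_continuous.
- exact: breveGammaQ_mxnorm.
- split; first exact: breveGammaQ_linear.
  by move=> mu nu; apply: cbMap_eq => f; exact: FQ_act_box.
- split; first by move=> mu _; exact: breveGammaQ_MQ.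
    by move=> mu nu _ _; exact: breveGammaQ_inj.
  by move=> S /MQ_sub_breveGammaQ[mu <-]; exists mu.
- exact: breveGammaQ_etaQ.
Qed.
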